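(* Let $f:\{0,1\}^r\to\{0,1\}$ be monotone, non-constant, not a dictator, with $D_0(f)=1$. Let $j$ be the index with $f(e_j)=1$, write $f(x)=x_j\vee\tilde f(x_{-j})$ with $\tilde f$ the residual rule of $f$, and let $m=m(f)\ge 2$ be the least size of a minterm of $\tilde f$. Then $$\max_{1\le s\le N-1}\mathbb{E}[T\mid S_0=s]=\Theta\bigl(N^{2-1/m}\bigr)\qquad(N\ge2),$$ with implied constants depending only on $f$; and there is $\varepsilon=\varepsilon(f)>0$ such that the lower bound already holds at $s=\lceil\varepsilon N^{(m-1)/m}\rceil$. The same holds by duality when $f$ is monotone, non-constant, not a dictator, with $D_1(f)=1$: then, with $m=m(f^* )$, $\max_{1\le s\le N-1}\mathbb{E}[T\mid S_0=s]=\Theta(N^{2-1/m})$, the lower bound already holding at $s=N-\lceil\varepsilon N^{(m-1)/m}\rceil$ for a suitable $\varepsilon=\varepsilon(f)>0$. Consequently, for every non-dictator monotone non-constant $f$ with $D_0(f)=1$ or $D_1(f)=1$, the bound $\max_{1\le s\le N-1}\mathbb{E}[T\mid S_0=s]=O(N\log N)$ fails; and the exponent $2-1/m$ tends to $2$ as $m\to\infty$.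
   Context: Dynamics. Given $N\ge 2$ agents and a monotone non-constant $f:\{0,1\}^r\to\{0,1\}$ (so $f(\mathbf 0)=0$, $f(\mathbf 1)=1$), consider the discrete-time Markov chain $X^{(t)}\in\{0,1\}^N$ whose step is: draw $V$ uniform on $[N]$; draw $J_1,\dots,J_r$ i.i.d. uniform on $[N]$, independent of $V$ (all fresh at each step); set $X^{(t+1)}_V=f(X^{(t)}_{J_1},\dots,X^{(t)}_{J_r})$ and leave every other coordinate unchanged. $T=\inf\{t: X^{(t)}\text{ is constant}\}$ and $S_t=\#\{i:X_i^{(t)}=1\}$, itself a Markov chain. Notation. $e_i$ is the $i$th standard basis vector of $\{0,1\}^r$, $\mathbf 1$ the all-ones vector. $D_0(f)=\#\{i:f(e_i)=1\}$, $D_1(f)=\#\{i:f(\mathbf 1-e_i)=0\}$. A dictator is $f(x)=x_j$ for some fixed $j$. The dual is $f^*(x)=1-f(\mathbf 1-x)$; one has $D_0(f^* )=D_1(f)$. The residual rule of a non-dictator $f$ with $D_0(f)=1$, $f(e_j)=1$, is $\tilde f(x_{-j})=f(x^{j\to0})$, where $x_{-j}$ is $x$ with coordinate $j$ deleted and $x^{j\to 0}$ is $x$ with coordinate $j$ set to $0$. A minterm of a monotone Boolean function is an inclusion-minimal set $B$ of coordinates such that setting the coordinates in $B$ to $1$ and the rest to $0$ gives the value $1$. $m(f^* )$ denotes the least size of a minterm of the residual rule of $f^*$. *)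

(* Defs.v *)
From HB Require Import structures.
From mathcomp Require Import all_boot all_order all_algebra all_fingroup.
From mathcomp Require Import all_classical all_reals all_analysis.

Set Implicit Arguments.
Unset Strict Implicit.
Unset Printing Implicit Defensive.

Import Order.TTheory GRing.Theory Num.Theory.
Import numFieldNormedType.Exports.

Local Open Scope set_scope.
Local Open Scope nat_scope.

Definition cube (r : nat) := {ffun 'I_r -> bool}.

Definition boolean_rule (r : nat) := cube r -> bool.

Section Rules.
Variable r : nat.
Implicit Types (f : boolean_rule r) (x y : cube r) (i j : 'I_r).

Definition indicator (B : {set 'I_r}) : cube r := [ffun i => i \in B].
Definition basis_vec i : cube r := indicator [set i].
Definition cube_compl x : cube r := [ffun i => ~~ x i].

Definition monotone_rule f :=
  forall x y, (forall i, x i -> y i) -> f x -> f y.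
Definition constant_rule f := exists b, forall x, f x = b.
Definition dictator f := exists j, forall x, f x = x j.

Definition D0 f : nat := #|[set i | f (basis_vec i)]|.
Definition D1 f : nat := #|[set i | ~~ f (cube_compl (basis_vec i))]|.

Definition dual f : boolean_rule r := fun x => ~~ f (cube_compl x).

Definition minterm f (B : {set 'I_r}) : bool :=
  minset (fun A : {set 'I_r} => f (indicator A)) B.

(* No minterm has more than r elements, so the default value r of the iterated
   minimum matters only for a rule that has no minterm. *)
Definition min_minterm_size f : nat :=
  \big[minn/r]_(B : {set 'I_r} | minterm f B) #|B|.

(* The coordinates of 'I_r other than j are indexed by 'I_r.-1 through lift j. *)
Definition delete j x : cube r.-1 := [ffun k => x (lift j k)].

Definition insert0 j (y : cube r.-1) : cube r :=
  [ffun i => if unlift j i is Some k then y k else false].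

Definition residual f j : boolean_rule r.-1 :=
  fun y : cube r.-1 => f (insert0 j y).

Lemma min_minterm_size_le f (B : {set 'I_r}) :
  minterm f B -> min_minterm_size f <= #|B|.
Proof.
move=> fB; rewrite /min_minterm_size.
elim: index_enum (mem_index_enum B) => // A s IHs; rewrite inE big_cons.
case: eqVneq => [<- _|_ /= /IHs le_sB]; first by rewrite fB geq_minl.
by case: ifP => // _; rewrite geq_min le_sB orbT.
Qed.

Lemma min_minterm_size_attained f (B0 : {set 'I_r}) : minterm f B0 ->
  exists2 B, minterm f B & #|B| = min_minterm_size f.
Proof.
move=> fB0; case: (arg_minnP (fun B : {set 'I_r} => #|B|) fB0) => B fB Bmin.
exists B => //; apply/eqP; rewrite eqn_leq min_minterm_size_le // andbT.
rewrite /min_minterm_size; elim/big_ind: _ => //.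
- by rewrite -[X in _ <= X](card_ord r) max_card.
- by move=> a b Ba Bb; rewrite leq_min Ba.
Qed.

End Rules.

Section Dynamics.
Variables (N r : nat) (f : boolean_rule r).
Implicit Types x : {ffun 'I_N -> bool}.

Definition state := {ffun 'I_N -> bool}.

(* One step's randomness (V, (J_1, ..., J_r)): a uniform element of this type
   has V and all J_k independent and uniform on 'I_N. *)
Definition draw : Type := ('I_N * {ffun 'I_r -> 'I_N})%type.

Definition step x (d : draw) : state :=
  [ffun i => if i == d.1 then f [ffun k => x (d.2 k)] else x i].

Definition run x (w : seq draw) : state := foldl step x w.

Definition consensus x : bool := [exists b, [forall i, x i == b]].

Definition num_ones x : nat := #|[set i | x i]|.

(* Along the trajectory from x driven by w, the first constant configuration is
   the last one, i.e. T = size w. *)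
Definition hits_exactly x (w : seq draw) : bool :=
  consensus (run x w) &&
  [forall k : 'I_(size w), ~~ consensus (run x (take k w))].

Definition first_ones (s : nat) : state := [ffun i : 'I_N => i < s].

End Dynamics.

Section HittingTime.
Variables (R : realType) (N r : nat) (f : boolean_rule r).
Local Open Scope ring_scope.

(* P(T = t | X^(0) = x): the event {T = t} is determined by the first t draws,
   which are i.i.d. uniform. *)
Definition hit_prob (x : state N) (t : nat) : R :=
  #|[set w : t.-tuple (draw N r) | hits_exactly f x w]|%:R
    / #|{: t.-tuple (draw N r)}|%:R.

Definition never_prob (x : state N) : \bar R :=
  (1 - \sum_(0 <= t <oo) (hit_prob x t)%:E)%E.

(* The expectation of the [0, +oo]-valued variable T; here +oo * 0 = 0. *)
Definition mean_time_from (x : state N) : \bar R :=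
  (\sum_(0 <= t <oo) (t%:R * hit_prob x t)%:E + +oo * never_prob x)%E.

End HittingTime.

(* E[T | S_0 = s], computed from the initial configuration in which exactly the
   first s agents hold 1; by mean_time_from_num_ones below, any other
   configuration with s ones gives the same value. *)
Definition mean_time (R : realType) (r : nat) (f : boolean_rule r) (N s : nat)
  : \bar R := mean_time_from R f (first_ones N s).

Definition max_mean_time (R : realType) (r : nat) (f : boolean_rule r)
    (N : nat) : \bar R :=
  \big[maxe/-oo%E]_(1 <= s < N) mean_time R f N s.

Section Exchangeability.
Variables (N r : nat) (f : boolean_rule r).
Implicit Types (x y : state N) (p : 'S_N) (d : draw N r).

Let relabel p x : state N := [ffun i => x (p i)].
Let relabel_draw p d : draw N r := ((p^-1)%g d.1, [ffun k => (p^-1)%g (d.2 k)]).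

Let step_relabel p x d :
  step f (relabel p x) (relabel_draw p d) = relabel p (step f x d).
Proof.
apply/ffunP => i; rewrite !ffunE /= -(inj_eq (@perm_inj _ p)) permKV.
case: ifP => // _; congr (f _); apply/ffunP => k.
by rewrite !ffunE permKV.
Qed.

Let run_relabel p x w :
  run f (relabel p x) (map (relabel_draw p) w) = relabel p (run f x w).
Proof.
elim: w x => //= d w IHw x.
by rewrite /run /= step_relabel; exact: IHw.
Qed.

Let consensus_relabel p x : consensus (relabel p x) = consensus x.
Proof.
apply/existsP/existsP => -[b /forallP xb]; exists b; apply/forallP => i.
  by have := xb ((p^-1)%g i); rewrite ffunE permKV.
by rewrite ffunE.
Qed.

Let hits_relabel p x w :
  hits_exactly f (relabel p x) (map (relabel_draw p) w) = hits_exactly f x w.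
Proof.
rewrite /hits_exactly run_relabel consensus_relabel; congr (_ && _).
apply/forallP/forallP => H k.
  have kw : k < size (map (relabel_draw p) w) by rewrite size_map.
  by have := H (Ordinal kw); rewrite /= -map_take run_relabel consensus_relabel.
have kw : k < size w by rewrite -[X in _ < X](size_map (relabel_draw p)).
by have := H (Ordinal kw); rewrite /= -map_take run_relabel consensus_relabel.
Qed.

Let relabel_draw_inj p : injective (relabel_draw p).
Proof.
move=> [v J] [v' J'] [/perm_inj -> /ffunP JJ']; congr (_, _).
by apply/ffunP => k; have := JJ' k; rewrite !ffunE => /perm_inj.
Qed.

Let hit_prob_relabel (R : realType) p x t :
  hit_prob R f (relabel p x) t = hit_prob R f x t.
Proof.
rewrite /hit_prob; congr (_%:R / _)%R.
pose h (w : t.-tuple (draw N r)) := [tuple of map (relabel_draw p) w].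
have h_inj : injective h.
  by move=> w w' /(congr1 val) /= /(inj_map (@relabel_draw_inj p)) /val_inj.
rewrite -[RHS](card_imset _ h_inj); apply/eq_card => w.
have [g hK gK] := injF_bij h_inj.
rewrite -(gK w) mem_imset // !inE.
exact: hits_relabel.
Qed.

Let relabel_exists x y : num_ones x = num_ones y ->
  exists p, y = relabel p x.
Proof.
move=> xy.
have cnt (z : state N) : count id (map z (enum 'I_N)) = num_ones z.
  rewrite count_map -sum1_count big_enum_cond /num_ones -sum1_card /=.
  by apply: eq_bigl => i; rewrite inE.
have: perm_eq (map y (enum 'I_N)) [tuple x i | i < N].
  change (perm_eq (map y (enum 'I_N)) (map x (enum 'I_N))).
  have h2 (z : state N) : count (pred1 false) (map z (enum 'I_N)) =
      N - count id (map z (enum 'I_N)).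
    rewrite -[X in X - _](size_enum_ord N) -(size_map z) -(count_predC id) addKn.
    by apply: eq_count => -[].
  apply/allP => b _ /=; apply/eqP; case: b.
    rewrite !(@eq_count _ (pred1 true) id); [|by case..].
    by rewrite !cnt xy.
  by rewrite !h2 !cnt xy.
case/tuple_permP => p yp; exists p; apply/ffunP => i.
rewrite ffunE.
have /(congr1 (fun s => nth false s i)) := yp.
by rewrite (nth_map i) ?size_enum_ord // nth_ord_enum
  -[nth _ _ _]/(nth false [tuple _ | _ < N] i) -tnth_nth !tnth_mktuple.
Qed.

Lemma mean_time_from_num_ones (R : realType) x s :
  num_ones x = s -> mean_time_from R f x = mean_time R f N s.
Proof.
move=> xs.
have sN : s <= N by rewrite -xs -[X in _ <= X](card_ord N) max_card.
have [|p ->] := @relabel_exists (first_ones N s) x.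
  rewrite xs /num_ones -sum1_card.
  rewrite (eq_bigl (fun i : 'I_N => i < s)); last by move=> i; rewrite inE ffunE.
  by rewrite (big_ord_narrow sN) sum1_card card_ord.
rewrite /mean_time /mean_time_from /never_prob.
by congr (_ + +oo * (1 - _))%E; apply: eq_eseriesr => t _;
  rewrite hit_prob_relabel.
Qed.

End Exchangeability.

(* Main.v *)
Require Import Defs.
From mathcomp Require Import all_boot all_order all_algebra.
From mathcomp Require Import all_classical all_reals all_analysis.
From mathcomp Require Import ring lra zify.

(** With s agents holding 1 and p = s/N, the number of ones moves up with
    probability (1 - p) h and down with probability p (1 - h), where h is the
    probability that f accepts r independent samples. As f is the disjunction
    of x_j and of the residual rule, h - p is (1 - p) times the probability
    that the residual rule accepts. That probability is at least p^m, from one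
    minterm of size m, and at most 2^r p^m, from a union bound over the
    possible sets of ones ([adopt_prob_ge], [adopt_prob_le]).

    So for small p the chain is a nearly neutral walk with variance rate of
    order s/N and upward drift of order (s/N)^m. Starting from s, noise alone
    needs a time of order N s to move the walk by s; in that time the drift
    moves it by N s (s/N)^m, which is comparable to s exactly at s =
    N^((m-1)/m), called [scale] below. Below this level the walk must first
    diffuse, for a time of order N scale = N^(2-1/m); above it the drift takes
    over, and the time to travel, the sum of (N/s)^m over s > scale, is again
    of order N scale since m >= 2. Absorption at N costs only the
    coupon-collector time N log N.

    Both directions are made rigorous by comparison with explicit functions of
    s. A function u >= 0 whose one-step average is at most u - 1 away from
    consensus bounds the mean of T from above ([truncated_mean_le]), and a
    bounded u that is nonpositive at consensus, with average at least u - 1,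
    bounds it from below ([mean_time_from_ge]).

    Lower bound: a multiple of the hump max(0, s - s^2/K) with K of order
    scale. Its curvature against the variance rate and its slope against the
    drift both contribute O(1/N) ([hump_drift_ge]), so it can be multiplied by
    N.

    Upper bound: let w be the downward increments of u; the condition on u
    reads (1 - p) h w(s) - p (1 - h) w(s - 1) >= 1, and it is preserved by
    taking the minimum of two sequences w, because the coefficient of w(s - 1)
    is negative. One sequence, logarithmic in s and negative below scale,
    handles the diffusive range; the other, B (N/s)^m N/(N - s), handles the
    range where the drift wins ([profile_step]). The sum of |w| is O(N scale)
    ([profile_sum_le]).

    The case D1 f = 1 follows by exchanging the two opinions
    ([mean_time_dual]). *)

Set Implicit Arguments.
Unset Strict Implicit.
Unset Printing Implicit Defensive.

Import Order.TTheory GRing.Theory Num.Theory.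
Import numFieldNormedType.Exports.
Local Open Scope ring_scope.

(** * Hitting times and one-step averages *)

Section HittingTime.
Variables (R : realType) (N r : nat) (f : boolean_rule r).
Hypothesis N_gt0 : (0 < N)%N.
Implicit Types (x : state N) (u : state N -> R).

Definition average (F : draw N r -> R) : R :=
  (\sum_d F d) / #|{: draw N r}|%:R.

Lemma card_draw_gt0 : 0 < #|{: draw N r}|%:R :> R.
Proof.
rewrite ltr0n; apply/card_gt0P.
by exists (Ordinal N_gt0, [ffun=> Ordinal N_gt0]).
Qed.

Lemma ler_average F G : (forall d, F d <= G d) -> average F <= average G.
Proof.
move=> FG; rewrite ler_pM2r ?invr_gt0 ?card_draw_gt0 //.
by apply: ler_sum => d _.
Qed.

Lemma eq_average F G : F =1 G -> average F = average G.
Proof. by move=> FG; congr (_ / _); apply: eq_bigr => d _. Qed.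

Lemma averageD F G :
  average (fun d => F d + G d) = average F + average G.
Proof. by rewrite /average big_split mulrDl. Qed.

Lemma averageZ k F : average (fun d => k * F d) = k * average F.
Proof. by rewrite /average -mulr_sumr mulrA. Qed.

Lemma average_cst k : average (fun=> k) = k.
Proof.
rewrite /average sumr_const -[k *+ _]mulr_natr mulfK //.
by rewrite gt_eqF ?card_draw_gt0.
Qed.

Lemma hits_exactly_cons x (d : draw N r) w :
  hits_exactly f x (d :: w) = ~~ consensus x && hits_exactly f (step f x d) w.
Proof.
rewrite /hits_exactly /= andbCA; congr (_ && _).
apply/forallP/andP => [H|[x_nc /forallP H] [[|k] klt]] //=.
  split; first exact: (H ord0).
  by apply/forallP => k; exact: (H (lift ord0 k)).
exact: (H (Ordinal (klt : (k < size w)%N))).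
Qed.

Lemma hit_prob0 x : hit_prob R f x 0 = (consensus x)%:R.
Proof.
rewrite /hit_prob card_tuple expn0 divr1; congr (_%:R).
rewrite (eq_card (B := [pred w | consensus x])) => [|w]; last first.
  rewrite !finset.inE tuple0 /hits_exactly /= andb_idr // => _.
  by apply/forallP => -[].
by case: (consensus x); rewrite ?card0 // card_tuple.
Qed.

Lemma hit_probS x t : hit_prob R f x t.+1 =
  if consensus x then 0 else average (fun d => hit_prob R f (step f x d) t).
Proof.
have countE n y : #|[set w : n.-tuple (draw N r) | hits_exactly f y w]|%:R =
    \sum_(w : n.-tuple (draw N r)) (hits_exactly f y w)%:R :> R.
  rewrite -sum1_card natr_sum big_mkcond /=; apply: eq_bigr => w _.
  by rewrite finset.inE; case: hits_exactly.
rewrite /hit_prob countE.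
pose h (p : draw N r * t.-tuple (draw N r)) := [tuple of p.1 :: p.2].
rewrite (reindex h) /=; last first.
  exists (fun w => (thead w, [tuple of behead w])) => [[d w] _|w _].
    by congr (_, _); apply/val_inj.
  by rewrite /h [RHS]tuple_eta; apply/val_inj.
rewrite -(pair_bigA _ (fun d w => (hits_exactly f x (d :: tval w))%:R)) /=.
case: ifPn => [x_c|x_nc].
  rewrite big1 ?mul0r // => d _; rewrite big1 // => w _.
  by rewrite hits_exactly_cons x_c.
rewrite /average -mulr_suml !card_tuple expnSr natrM invfM mulrA.
congr (_ / _); first congr (_ / _).
apply: eq_bigr => d _; rewrite countE; apply: eq_bigr => w _.
by rewrite hits_exactly_cons x_nc.
Qed.

Lemma hit_prob_ge0 x t : 0 <= hit_prob R f x t.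
Proof. by rewrite divr_ge0. Qed.

(** P(T > n) and E[min(T, n)] are defined through the first step, the form in
    which they are compared with super- and subharmonic functions;
    [sum_hit_prob] and [truncated_meanE] tie them to the law of T. *)
Fixpoint survival x n : R :=
  if consensus x then 0 else
  if n is n'.+1 then average (fun d => survival (step f x d) n') else 1.

Fixpoint truncated_mean x n : R :=
  if n is n'.+1 then
    if consensus x then 0
    else 1 + average (fun d => truncated_mean (step f x d) n')
  else 0.

Lemma survival_ge0 x n : 0 <= survival x n.
Proof.
elim: n x => [|n IHn] x /=; case: ifP => // _.
by rewrite -(average_cst 0); apply: ler_average => d.
Qed.

Lemma average_sum (I : Type) (s : seq I) (F : I -> draw N r -> R) :
  average (fun d => \sum_(i <- s) F i d) = \sum_(i <- s) average (F i).
Proof. by rewrite /average exchange_big /= mulr_suml. Qed.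

Lemma sum_hit_prob x n :
  \sum_(0 <= t < n.+1) hit_prob R f x t = 1 - survival x n.
Proof.
elim: n x => [|n IHn] x.
  by rewrite big_nat1 hit_prob0 /=; case: consensus; rewrite ?subr0 ?subrr.
rewrite big_nat_recl // hit_prob0 /=.
under eq_bigr do rewrite hit_probS.
case: ifP => _; first by rewrite big1 // subr0 addr0.
rewrite add0r -average_sum -{1}(average_cst 1) -mulN1r -averageZ -averageD.
by apply: eq_average => d; rewrite IHn mulN1r.
Qed.

(** The left-hand side is E[min(T, n)] split according to whether T <= n. *)
Lemma truncated_meanE x n :
  \sum_(0 <= t < n.+1) t%:R * hit_prob R f x t + n%:R * survival x n =
  truncated_mean x n.
Proof.
elim: n x => [|n IHn] x.
  by rewrite big_nat1 /= mul0r mul0r addr0.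
rewrite big_nat_recl // mul0r add0r /=.
under eq_bigr do rewrite hit_probS.
case: ifP => _; first by rewrite big1 ?mulr0 ?addr0 // => t _; rewrite mulr0.
pose H t := average (fun d => hit_prob R f (step f x d) t).
have survE : average (fun d => survival (step f x d) n) =
    1 - \sum_(0 <= t < n.+1) H t.
  rewrite -average_sum -{1}(average_cst 1) -mulN1r -averageZ -averageD.
  by apply: eq_average => d; rewrite sum_hit_prob; ring.
have -> : average (fun d => truncated_mean (step f x d) n) =
    \sum_(0 <= t < n.+1) t%:R * H t
    + n%:R * average (fun d => survival (step f x d) n).
  under eq_bigr do rewrite -averageZ.
  rewrite -average_sum -averageZ -averageD.
  by apply: eq_average => d; rewrite IHn.
under eq_bigr do rewrite -natr1 mulrDl mul1r.
by rewrite big_split /= survE -natr1; ring.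
Qed.

(** Away from consensus u loses at least 1 per step on average, and what is
    left of it after n steps is still nonnegative. *)
Lemma truncated_mean_le u : (forall x, 0 <= u x) ->
  (forall x, ~~ consensus x -> average (fun d => u (step f x d)) <= u x - 1) ->
  forall x n, truncated_mean x n <= u x.
Proof.
move=> u_ge0 u_super x n; elim: n x => [|n IHn] x //=.
case: ifPn => [_|/u_super]; first exact: u_ge0.
rewrite lerBrDl; apply: le_trans; rewrite lerD2l.
exact: ler_average.
Qed.

(** The survivors at time n keep at most M each, whence the correction. *)
Lemma truncated_mean_ge u M : (forall x, u x <= M) ->
  (forall x, consensus x -> u x <= 0) ->
  (forall x, ~~ consensus x -> u x - 1 <= average (fun d => u (step f x d))) ->
  forall x n, u x <= truncated_mean x n + M * survival x n.
Proof.
move=> u_leM u_cons u_sub x n; elim: n x => [|n IHn] x /=.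
  by case: ifPn => [/u_cons|_]; rewrite add0r ?mulr0 ?mulr1.
case: ifPn => [/u_cons|/u_sub]; first by rewrite mulr0 addr0.
rewrite lerBlDl => /le_trans; apply; rewrite -addrA lerD2l -averageZ -averageD.
exact: ler_average.
Qed.

(** Markov's inequality: n P(T > n) is at most E[min(T, n)]. *)
Lemma survival_cvg0 x U : (forall n, truncated_mean x n <= U) ->
  (survival x @ \oo --> (0 : R))%classic.
Proof.
move=> tm_le.
have bound n : n%:R * survival x n <= U.
  apply: le_trans (tm_le n); rewrite -truncated_meanE lerDr.
  by apply: sumr_ge0 => t _; rewrite mulr_ge0 ?hit_prob_ge0.
apply/cvgr0Pnorm_lt => e e0.
near=> n; rewrite ger0_norm ?survival_ge0 //.
have n0 : 0 < n%:R :> R by near: n; exact: nbhs_infty_gtr.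
rewrite -(ltr_pM2l n0); apply: le_lt_trans (bound n) _.
rewrite -ltr_pdivrMr //; near: n; exact: nbhs_infty_gtr.
Unshelve. all: by end_near. Qed.

Lemma mean_time_fromE x : (survival x @ \oo --> (0 : R))%classic ->
  mean_time_from R f x =
  (\sum_(0 <= t <oo) (t%:R * hit_prob R f x t)%:E)%E.
Proof.
move=> s0; rewrite /mean_time_from /never_prob.
suff -> : (\sum_(0 <= t <oo) (hit_prob R f x t)%:E = 1)%E.
  by rewrite subee // mule0 adde0.
apply/cvg_lim => //; rewrite -(cvg_shiftn 1) /=.
under eq_fun do rewrite addn1 sumEFin sum_hit_prob.
apply/fine_cvgP; split; first by near=> n.
rewrite -[X in (_ --> X)%classic](subr0 1); apply: cvgB => //; exact: cvg_cst.
Unshelve. all: by end_near. Qed.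

Lemma mean_time_from_le x U : (forall n, truncated_mean x n <= U) ->
  (mean_time_from R f x <= U%:E)%E.
Proof.
move=> tm_le; rewrite mean_time_fromE; last exact: survival_cvg0 tm_le.
apply: lime_le.
  by apply: is_cvg_nneseries => n _ _; rewrite lee_fin mulr_ge0 ?hit_prob_ge0.
near=> n; rewrite sumEFin lee_fin; apply: le_trans (tm_le n).
rewrite -truncated_meanE big_nat_recr //= -addrA lerDl.
by rewrite addr_ge0 ?mulr_ge0 ?hit_prob_ge0 ?survival_ge0.
Unshelve. all: by end_near. Qed.

(** Past the first n terms, the sum of t P(T = t) is at least n (P(T > n) -
    P(T > k)) for every k, and P(T > k) tends to 0. *)
Lemma truncated_mean_le_mean x n : (survival x @ \oo --> (0 : R))%classic ->
  ((truncated_mean x n)%:E <= mean_time_from R f x)%E.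
Proof.
move=> s0; rewrite mean_time_fromE //.
have term_ge0 t : 0 <= t%:R * hit_prob R f x t.
  by rewrite mulr_ge0 ?hit_prob_ge0.
set S := (X in (_ <= X)%E).
have lower k : (n <= k)%N ->
    ((truncated_mean x n - n%:R * survival x k)%:E <= S)%E.
  move=> nk; apply: (@le_trans _ _
      (\sum_(0 <= t < k.+1) (t%:R * hit_prob R f x t)%:E)%E); last first.
    by apply: nneseries_lim_ge => t _ _; rewrite lee_fin.
  rewrite sumEFin lee_fin -truncated_meanE.
  rewrite (big_cat_nat (n := n.+1) (p := k.+1)) //= -addrA lerD2l -mulrBr.
  have -> : survival x n - survival x k =
      \sum_(n.+1 <= t < k.+1) hit_prob R f x t.
    have := sum_hit_prob x k; rewrite (big_cat_nat (n := n.+1)) //=.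
    by rewrite sum_hit_prob => /eqP; rewrite -subr_eq => /eqP; lra.
  rewrite mulr_sumr; apply: ler_sum_nat => t /andP[nt _].
  by rewrite ler_wpM2r ?hit_prob_ge0 // ler_nat ltnW.
apply/lee_addgt0Pr => e e0.
have ns0 : ((fun k => n%:R * survival x k) @ \oo --> (0 : R))%classic.
  rewrite -[X in (_ --> X)%classic](mulr0 n%:R).
  by apply: cvgM s0; exact: cvg_cst.
have /cvgr0Pnorm_le/(_ e e0) [k0 _ k0P] := ns0.
have := lower (maxn n k0) (leq_maxl _ _).
have := k0P (maxn n k0) (leq_maxr _ _).
rewrite /= ger0_norm ?mulr_ge0 ?survival_ge0 // => small.
move=> /(leeD2r e%:E); apply: le_trans; rewrite -EFinD lee_fin; lra.
Qed.

Lemma mean_time_from_ge u M x : (forall y, u y <= M) ->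
  (forall y, consensus y -> u y <= 0) ->
  (forall y, ~~ consensus y -> u y - 1 <= average (fun d => u (step f y d))) ->
  (survival x @ \oo --> (0 : R))%classic ->
  ((u x)%:E <= mean_time_from R f x)%E.
Proof.
move=> uM u_cons u_sub s0; apply/lee_addgt0Pr => e e0.
have Ms0 : ((fun k => M * survival x k) @ \oo --> (0 : R))%classic.
  by rewrite -[X in (_ --> X)%classic](mulr0 M); apply: cvgM s0; exact: cvg_cst.
have /cvgr0Pnorm_le/(_ e e0) [k _ /(_ k (leqnn k)) small] := Ms0.
have := truncated_mean_ge uM u_cons u_sub x k.
have /(leeD2r e%:E) := truncated_mean_le_mean k s0.
move=> le1 le2; apply: le_trans le1; rewrite -EFinD lee_fin.
apply: le_trans le2 _; rewrite lerD2l; exact: le_trans (ler_norm _) small.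
Qed.
End HittingTime.

(** * One step of the chain *)

Section Sampling.
Variables (R : realType) (N r : nat).
Hypothesis N_gt0 : (0 < N)%N.
Implicit Types (x : state N) (P Q : pred {ffun 'I_r -> 'I_N}).

(** The samples J_1, ..., J_r are the values of a uniform function J. *)
Definition sample_prob P : R := (\sum_J (P J)%:R) / N%:R ^+ r.

Definition density x : R := (num_ones x)%:R / N%:R.

Let N_neq0 : N%:R != 0 :> R. Proof. by rewrite pnatr_eq0 -lt0n. Qed.

Lemma ler_sample_prob P Q : (forall J, P J -> Q J) ->
  sample_prob P <= sample_prob Q.
Proof.
move=> PQ; rewrite ler_wpM2r ?invr_ge0 ?exprn_ge0 //.
apply: ler_sum => J _; rewrite ler_nat.
by case: (P J) (PQ J) => // ->.
Qed.

Lemma sample_prob_union (I : finType) (F : I -> pred {ffun 'I_r -> 'I_N}) P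
    (A : pred I) : (forall J, P J -> exists2 i, A i & F i J) ->
  sample_prob P <= \sum_(i | A i) sample_prob (F i).
Proof.
move=> PF; rewrite /sample_prob -mulr_suml exchange_big /=.
rewrite ler_wpM2r ?invr_ge0 ?exprn_ge0 //.
apply: ler_sum => J _; case: (boolP (P J)) => [/PF[i Ai FiJ]|_].
  by rewrite (bigD1 i) //= FiJ lerDl; apply: sumr_ge0.
exact: sumr_ge0.
Qed.

Lemma sample_probD P Q :
  sample_prob P = sample_prob (predI P Q) + sample_prob (predI P (predC Q)).
Proof.
rewrite /sample_prob -mulrDl -big_split; congr (_ / _).
apply: eq_bigr => J _ /=.
by case: (P J) (Q J) => -[]; rewrite ?addr0 ?add0r.
Qed.

Lemma sample_prob1 : sample_prob predT = 1.
Proof.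
rewrite /sample_prob sumr_const card_ffun !card_ord -[1%:R *+ _]mulr_natr.
by rewrite mul1r natrX divff // expf_neq0.
Qed.

Lemma sample_prob_indep (F : 'I_r -> pred 'I_N) :
  sample_prob (fun J => [forall i, F i (J i)]) =
  \prod_i ((\sum_v (F i v)%:R) / N%:R).
Proof.
rewrite /sample_prob big_split /= prodr_const card_ord exprVn; congr (_ / _).
rewrite bigA_distr_bigA /=; apply: eq_bigr => J _.
rewrite -natr_prod; congr _%:R.
case: forallP => [FJ|/forallP]; first by rewrite big1 // => i _; rewrite FJ.
by rewrite negb_forall => /existsP[i /negbTE Fi]; rewrite (bigD1 i) //= Fi.
Qed.

Lemma sum_ones x : \sum_v (x v)%:R = (num_ones x)%:R :> R.
Proof.
rewrite /num_ones -sum1_card natr_sum [RHS]big_mkcond.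
by apply: eq_bigr => v _; rewrite finset.inE; case: (x v).
Qed.

Lemma sum_zeros x : \sum_v (~~ x v)%:R = N%:R - (num_ones x)%:R :> R.
Proof.
rewrite -sum_ones -[in X in X - _](card_ord N) -sum1_card natr_sum -sumrB.
by apply: eq_bigr => v _; case: (x v); rewrite ?subrr ?subr0.
Qed.

Let sum_true : (\sum_(v < N) 1) / N%:R = 1 :> R.
Proof. by rewrite sumr_const card_ord divff. Qed.

Lemma sample_prob_ones x (A : {set 'I_r}) :
  sample_prob (fun J => [forall i, (i \in A) ==> x (J i)]) = density x ^+ #|A|.
Proof.
rewrite (sample_prob_indep (fun i v => (i \in A) ==> x v)).
rewrite -prodr_const [RHS]big_mkcond; apply: eq_bigr => i _ /=.
by case: (i \in A); rewrite /= ?sum_ones ?sum_true.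
Qed.

Lemma sample_prob_zero_ones x (j : 'I_r) (A : {set 'I_r}) : j \notin A ->
  sample_prob (fun J => ~~ x (J j) && [forall i, (i \in A) ==> x (J i)]) =
  (1 - density x) * density x ^+ #|A|.
Proof.
move=> jA.
pose F i v := if i == j then ~~ x v else (i \in A) ==> x v.
have -> : sample_prob (fun J => ~~ x (J j) && [forall i, (i \in A) ==> x (J i)])
    = sample_prob (fun J => [forall i, F i (J i)]).
  rewrite /sample_prob; congr (_ / _); apply: eq_bigr => J _.
  congr (nat_of_bool _)%:R.
  apply/andP/forallP => [[xj /forallP xA] i|FJ].
    by rewrite /F; case: eqP => [->|_].
  split; first by have := FJ j; rewrite /F eqxx.
  apply/forallP => i; have := FJ i; rewrite /F; case: eqP => // -> _.
  by rewrite (negbTE jA).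
rewrite sample_prob_indep (bigD1 j) //= {1}/F eqxx sum_zeros mulrBl divff //.
congr (_ * _); rewrite -prodr_const big_mkcond [RHS]big_mkcond /=.
apply: eq_bigr => i _; rewrite /F; case: eqP => [->|_].
  by rewrite (negbTE jA).
by case: (i \in A); rewrite /= ?sum_ones ?sum_true.
Qed.

Lemma density_ge0 x : 0 <= density x.
Proof. by rewrite divr_ge0. Qed.

Lemma density_le1 x : density x <= 1.
Proof.
rewrite ler_pdivrMr ?ltr0n // mul1r ler_nat.
by rewrite -[X in (_ <= X)%N](card_ord N) max_card.
Qed.

End Sampling.

Section Adoption.
Variables (R : realType) (N r : nat) (f : boolean_rule r).
Hypothesis N_gt0 : (0 < N)%N.
Implicit Types x : state N.

Definition adopt_prob x : R :=
  sample_prob R (fun J : {ffun 'I_r -> 'I_N} => f [ffun k => x (J k)]).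

Lemma num_ones_step x (d : draw N r) :
  num_ones (step f x d) =
  if x d.1 then
    if f [ffun k => x (d.2 k)] then num_ones x else (num_ones x).-1
  else if f [ffun k => x (d.2 k)] then (num_ones x).+1 else num_ones x.
Proof.
set b := f _; pose S := [set i | x i]%SET.
have -> : num_ones (step f x d) =
    #|if b then (d.1 |: S)%SET else (S :\ d.1)%SET|.
  apply: eq_card => i; rewrite !finset.inE ffunE -/b.
  by case: ifP => [/eqP ->|id]; case: (b); rewrite !finset.inE ?eqxx ?id.
rewrite /num_ones -/S.
have -> : x d.1 = (d.1 \in S) by rewrite finset.inE.
case: b; first by rewrite cardsU1; case: (d.1 \in S).
by rewrite [in RHS](cardsD1 d.1 S); case: (d.1 \in S).
Qed.

(** The updated agent and the samples are independent, so the two ways of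
    changing the number of ones have product probabilities. *)
Lemma average_num_ones (u : nat -> R) x (s := num_ones x) :
  average (fun d => u (num_ones (step f x d))) =
  u s + ((1 - density R x) * adopt_prob x * (u s.+1 - u s)
         + density R x * (1 - adopt_prob x) * (u s.-1 - u s)).
Proof.
set F := fun J : {ffun 'I_r -> 'I_N} => f [ffun k => x (J k)].
pose up := u s.+1 - u s; pose down := u s.-1 - u s.
rewrite -{1}(average_cst r N_gt0 (u s)).
have -> : average (fun d => u (num_ones (step f x d))) =
    average (fun d : draw N r => u s) +
    (average (fun d : draw N r => (~~ x d.1)%:R * (F d.2)%:R * up)
     + average (fun d : draw N r => (x d.1)%:R * (~~ F d.2)%:R * down)).
  rewrite -!averageD; apply: eq_average => d.
  rewrite num_ones_step -/s -/(F d.2).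
  by rewrite /up /down; case: (x d.1); case: (F d.2) => /=; ring.
have prodE (a : pred 'I_N) (b : pred {ffun 'I_r -> 'I_N}) k :
    average (fun d : draw N r => (a d.1)%:R * (b d.2)%:R * k) =
    (\sum_v (a v)%:R) / N%:R * sample_prob R b * k.
  rewrite /average -mulr_suml card_prod card_ffun !card_ord.
  rewrite -(pair_bigA _ (fun v J => (a v)%:R * (b J)%:R)) /=.
  under eq_bigr do rewrite -mulr_sumr.
  rewrite -mulr_suml natrM natrX invfM /sample_prob.
  ring.
rewrite (prodE (fun v => ~~ x v) F) (prodE x (fun J => ~~ F J)).
rewrite sum_zeros sum_ones -/up -/down mulrBl divff ?pnatr_eq0 -?lt0n //.
congr (_ + (_ * _ + _ * _ * _)).
apply/eqP; rewrite eq_sym subr_eq addrC -(sample_prob1 R r N_gt0); apply/eqP.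
exact: (sample_probD R predT F).
Qed.

End Adoption.

(** * Rules with one unit minterm *)

Section MonotoneRules.
Variable r : nat.
Implicit Types (f : boolean_rule r) (x y : cube r) (i j : 'I_r).

Lemma monotone_rule0 f : monotone_rule f -> ~ constant_rule f ->
  ~~ f [ffun=> false].
Proof.
move=> f_mon f_nc; apply/negP => f0; apply: f_nc; exists true => x.
by apply: (f_mon _ _ _ f0) => i; rewrite ffunE.
Qed.

Lemma insert0_delete j x : ~~ x j -> insert0 j (delete j x) = x.
Proof.
move=> xj; apply/ffunP => i; rewrite ffunE.
by case: unliftP => [k ->|->]; rewrite ?ffunE // (negbTE xj).
Qed.

Lemma residualE f j : monotone_rule f -> f (basis_vec j) ->
  forall x, f x = x j || residual f j (delete j x).
Proof.
move=> f_mon fj x; case: (boolP (x j)) => [xj|xj] /=.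
  apply: (f_mon _ _ _ fj) => i; rewrite ffunE finset.inE => /eqP ->.
  exact: xj.
by rewrite /residual insert0_delete.
Qed.

Lemma indicator_support x : indicator [set i | x i]%SET = x.
Proof. by apply/ffunP => i; rewrite ffunE finset.inE. Qed.

Lemma minterm_below f y : f y ->
  exists2 B : {set 'I_r}, minterm f B & forall i, i \in B -> y i.
Proof.
move=> fy.
have [B fB /fintype.subsetP By] : {B : {set 'I_r} | minterm f B
    & B \subset [set i | y i]%SET}.
  by apply: minset_exists; rewrite indicator_support.
by exists B => // i /By; rewrite finset.inE.
Qed.

End MonotoneRules.

Section ResidualRule.
Variables (r : nat) (f : boolean_rule r) (j : 'I_r).
Hypotheses (f_mon : monotone_rule f) (f_nc : ~ constant_rule f).
Hypotheses (f_nd : ~ dictator f) (f_D0 : D0 f = 1%N) (fj : f (basis_vec j)).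
Implicit Types (y : cube r).

Let m := min_minterm_size (residual f j).

Let residual_true : exists y : cube r.-1, residual f j y.
Proof.
have [/existsP //|/existsPn none] :=
  boolP [exists y : cube r.-1, residual f j y].
case: f_nd; exists j => x.
by rewrite (residualE f_mon fj) (negbTE (none _)) orbF.
Qed.

Let least_minterm :
  exists2 B : {set 'I_r.-1}, minterm (residual f j) B & #|B| = m.
Proof.
have [y /minterm_below[B fB _]] := residual_true.
exact: min_minterm_size_attained fB.
Qed.

(** Minterms of the residual rule live on one coordinate less; here and in
    [residual_support_ge] they are moved to the coordinates of f through [lift
    j]. *)
Lemma least_residual_minterm : exists B : {set 'I_r}, [/\ j \notin B, #|B| = m
  & forall y, (forall i, i \in B -> y i) -> f y].
Proof.
have [B fB Bm] := least_minterm; exists (lift j @: B)%SET; split.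
- by apply/imsetP => -[k _ jk]; have := neq_lift j k; rewrite -jk eqxx.
- by rewrite card_imset //; exact: lift_inj.
move=> y yB; apply: f_mon (minsetp fB) => i; rewrite ffunE.
case: unliftP => [k ->|//]; rewrite ffunE => kB.
by apply: yB; exact: imset_f.
Qed.

Lemma residual_support_ge y : f y -> ~~ y j -> (m <= #|[set i | y i]%SET|)%N.
Proof.
move=> fy yj.
have : residual f j (delete j y) by rewrite /residual insert0_delete.
case/minterm_below => B fB By; apply: leq_trans (min_minterm_size_le fB) _.
rewrite -(card_imset (mem B) (lift_inj (h := j))); apply: subset_leq_card.
apply/fintype.subsetP => _ /imsetP[k kB ->]; rewrite finset.inE.
by have := By k kB; rewrite ffunE.
Qed.

(** A minterm of size 1 would be a second unit vector accepted by f. *)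
Lemma residual_min_minterm_size_ge2 : (2 <= m)%N.
Proof.
have [B fB <-] := least_minterm.
have fB1 : f (insert0 j (indicator B)) := minsetp fB.
rewrite ltnNge; apply/negP; rewrite leq_eqVlt ltnS leqn0.
case/orP => [/cards1P[k Bk]|].
  have /card_le1P/(_ j) := eq_leq f_D0.
  rewrite finset.inE fj => /(_ isT (lift j k)); rewrite !finset.inE.
  rewrite eq_sym (negbTE (neq_lift j k)) => /negP; apply.
  apply: f_mon fB1 => i; rewrite ffunE.
  case: unliftP => [l ->|//]; rewrite !ffunE Bk !finset.inE => /eqP ->.
  by rewrite eqxx.
rewrite cards_eq0 => /eqP B0; have /negP := monotone_rule0 f_mon f_nc; apply.
apply: f_mon fB1 => i; rewrite ffunE.
by case: unliftP => [k ->|//]; rewrite ffunE B0 finset.inE.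
Qed.

Section AdoptionBounds.
Variables (R : realType) (N : nat).
Hypothesis N_gt0 : (0 < N)%N.
Variable x : state N.
Let p := density R x.

Let adopt_split : adopt_prob R f x = p + sample_prob R
  (fun J : {ffun 'I_r -> 'I_N} => ~~ x (J j) && f [ffun k => x (J k)]).
Proof.
rewrite /adopt_prob (sample_probD _ _ (fun J : {ffun 'I_r -> 'I_N} => x (J j))).
congr (_ + _).
  rewrite -[p]expr1 -(cards1 j) -sample_prob_ones //.
  congr (_ / _); apply: eq_bigr => J _; congr (nat_of_bool _)%:R => /=.
  rewrite (residualE f_mon fj) ffunE.
  apply/andP/forallP => [[_ xj] i|/(_ j)]; last first.
    by rewrite finset.set11 implyTb => xj; rewrite xj.
  by rewrite finset.inE; apply/implyP => /eqP ->.
by congr (_ / _); apply: eq_bigr => J _ /=; rewrite andbC.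
Qed.

(** One event in the excess of h over p: sample j holds 0 and the samples of a
    fixed smallest minterm all hold 1. *)
Lemma adopt_prob_ge : p + (1 - p) * p ^+ m <= adopt_prob R f x.
Proof.
have [B [jB <- fB]] := least_residual_minterm.
rewrite adopt_split lerD2l -(sample_prob_zero_ones R N_gt0 x jB).
apply: ler_sample_prob => J /andP[-> /forallP JB] /=.
by apply: fB => i iB; rewrite ffunE; exact: (implyP (JB i)).
Qed.

(** If sample j holds 0 and f accepts, the set of samples holding 1 has at
    least m elements; the union bound runs over all 2^r sets. *)
Lemma adopt_prob_le : adopt_prob R f x <= p + 2 ^+ r * p ^+ m.
Proof.
rewrite adopt_split lerD2l.
pose F (A : {set 'I_r}) (J : {ffun 'I_r -> 'I_N}) :=
  [forall i, (i \in A) ==> x (J i)].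
apply: le_trans (sample_prob_union (F := F)
  (A := fun A : {set 'I_r} => (m <= #|A|)%N) _ _) _ => //.
  move=> J /andP[xj fJ]; exists [set i | x (J i)]%SET; last first.
    by apply/forallP => i; rewrite finset.inE implybb.
  have := residual_support_ge fJ; rewrite ffunE => /(_ xj).
  by congr (_ <= _)%N; apply: eq_card => i; rewrite !finset.inE ffunE.
apply: (@le_trans _ _ (\sum_(A : {set 'I_r}) p ^+ m)).
  rewrite big_mkcond; apply: ler_sum => A _; case: ifP => mA.
    by rewrite sample_prob_ones // ler_wiXn2l ?density_ge0 ?density_le1.
  by rewrite exprn_ge0 // density_ge0.
rewrite sumr_const -cardsT -powersetT card_powerset cardsT card_ord.
by rewrite -[leLHS]mulr_natl natrX.
Qed.

End AdoptionBounds.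
End ResidualRule.

(** * Super- and subharmonic profiles of the number of ones *)

Lemma num_ones_le N (x : state N) : (num_ones x <= N)%N.
Proof. by rewrite -[X in (_ <= X)%N](card_ord N) max_card. Qed.

Lemma consensusE N (x : state N) :
  consensus x = (num_ones x == 0) || (num_ones x == N).
Proof.
apply/existsP/orP => [[[] /forallP xb]|[/eqP x0|/eqP xN]].
- right; rewrite /num_ones (_ : [set i | x i]%SET = [set: 'I_N]%SET).
    by rewrite cardsT card_ord.
  by apply/finset.setP => i; rewrite !finset.inE (eqP (xb i)).
- left; rewrite cards_eq0; apply/eqP/finset.setP => i.
  by rewrite !finset.inE (eqP (xb i)).
- exists false; apply/forallP => i; move/eqP: x0.
  rewrite cards_eq0 => /eqP/finset.setP/(_ i); rewrite !finset.inE => ->.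
  exact: eqxx.
exists true; apply/forallP => i.
have /eqP/finset.setP/(_ i) : [set i | x i]%SET == [set: 'I_N]%SET.
  by rewrite eqEcard finset.subsetT cardsT card_ord /= -[X in (X <= _)%N]xN.
by rewrite !finset.inE => ->.
Qed.

(** The only information about the rule that the comparison functions use. *)
Definition admissible (R : realType) (m : nat) (C p h : R) :=
  [/\ p + (1 - p) * p ^+ m <= h, h <= p + C * p ^+ m & h <= 1].

Section BirthDeath.
Variables (R : realType) (N r : nat) (f : boolean_rule r) (m : nat) (C : R).
Hypothesis N_gt0 : (0 < N)%N.
Hypothesis adoptP : forall x : state N,
  admissible m C (density R x) (adopt_prob R f x).
Implicit Types x : state N.

Let num_ones_interior x : ~~ consensus x -> (0 < num_ones x < N)%N.
Proof.
rewrite consensusE negb_or -lt0n => /andP[-> xN] /=.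
by rewrite ltn_neqAle xN num_ones_le.
Qed.

(** The comparison function is u(s) = c - w(0) - ... - w(s - 1), whose
    one-step decrease is the left-hand side of the hypothesis. The constant c
    only has to make u nonnegative, and the sum of |w| does. *)
Lemma truncated_mean_le_sum (w : nat -> R) :
  (forall s h, (0 < s < N)%N -> admissible m C (s%:R / N%:R) h ->
    1 <= (1 - s%:R / N%:R) * h * w s - s%:R / N%:R * (1 - h) * w s.-1) ->
  forall x n, truncated_mean R f x n <= (\sum_(0 <= k < N) `|w k|) *+ 2.
Proof.
move=> wP x n.
pose u s := \sum_(0 <= k < N) `|w k| - \sum_(0 <= k < s) w k.
have absS s : (s <= N)%N ->
    `|\sum_(0 <= k < s) w k| <= \sum_(0 <= k < N) `|w k|.
  move=> sN; apply: le_trans (ler_norm_sum _ _ _) _.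
  by rewrite [leRHS](big_cat_nat (n := s)) //= lerDl sumr_ge0.
apply: (@le_trans _ _ (u (num_ones x))); last first.
  rewrite mulr2n lerD2l; apply: le_trans (absS _ (num_ones_le x)).
  by rewrite -normrN ler_norm.
apply: (truncated_mean_le N_gt0 (u := fun y => u (num_ones y))) => [y|y y_nc].
  by rewrite subr_ge0; exact: le_trans (ler_norm _) (absS _ (num_ones_le y)).
have /andP[s_gt0 sN] := num_ones_interior y_nc.
rewrite average_num_ones // lerD2l.
have := wP _ _ (num_ones_interior y_nc) (adoptP y); rewrite -/(density R y).
rewrite /u; case: (num_ones y) s_gt0 => // s _ /=.
by rewrite !big_nat_recr //=; lra.
Qed.

(** Below K the slope of the hump is at least -1 and the excess of up- over
    down-moves is at most C (K/N)^m; its second difference is -2/K and the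
    total rate of moves at most (2 + C) K/N. As K^m <= M N^(m-1), both effects
    are O(1/N). Replacing the parabola by 0 beyond K can only increase the
    average. *)
Lemma hump_drift_ge (K s : nat) (M h : R) (q : nat -> R)
    (p : R := s%:R / N%:R) :
  0 <= C -> (0 < s < N)%N -> (0 < m)%N -> (0 < K)%N ->
  K%:R ^+ m <= M * N%:R ^+ m.-1 -> admissible m C p h ->
  (forall t, q t = Num.max 0 (t%:R - t%:R ^+ 2 / K%:R)) ->
  - ((C * M + 2 + C) / N%:R) <=
    (1 - p) * h * (q s.+1 - q s) + p * (1 - h) * (q s.-1 - q s).
Proof.
move=> C0 /andP[s_gt0 sN] m_gt0 K_gt0 KM [h_ge h_le h_le1] qE.
have NR : 0 < N%:R :> R by rewrite ltr0n (leq_trans _ sN).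
have KR : 0 < K%:R :> R by rewrite ltr0n.
have p0 : 0 <= p by rewrite divr_ge0.
have p1 : p <= 1 by rewrite ler_pdivrMr // mul1r ler_nat ltnW.
have pm0 : 0 <= p ^+ m by rewrite exprn_ge0.
have pm1 : p ^+ m <= p by rewrite -[leRHS]expr1 ler_wiXn2l.
have hp : p <= h by apply: le_trans h_ge; rewrite lerDl mulr_ge0 // subr_ge0.
have M0 : 0 <= M.
  have := le_trans (exprn_ge0 m (ltW KR)) KM.
  by rewrite pmulr_lge0 // exprn_gt0.
have h0 : 0 <= h by exact: le_trans hp.
have a0 : 0 <= (1 - p) * h by rewrite mulr_ge0 ?subr_ge0.
have b0 : 0 <= p * (1 - h) by rewrite mulr_ge0 ?subr_ge0.
have q_ge0 t : 0 <= q t by rewrite qE le_max lexx.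
have q_ge t : t%:R - t%:R ^+ 2 / K%:R <= q t by rewrite qE le_max lexx orbT.
have [Ks|sK] := leqP K s.
  have -> : q s = 0.
    rewrite qE; apply/max_idPl; rewrite subr_le0 ler_pdivlMr // expr2.
    by rewrite ler_wpM2l // ler_nat.
  rewrite !subr0; apply: (@le_trans _ _ 0).
    2: by apply: addr_ge0; apply: mulr_ge0.
  by rewrite oppr_le0 divr_ge0 ?addr_ge0 ?mulr_ge0.
have qsE : q s = s%:R - s%:R ^+ 2 / K%:R.
  rewrite qE; apply/max_idPr; rewrite subr_ge0 ler_pdivrMr // expr2.
  by rewrite ler_wpM2l // ler_nat ltnW.
set k := K%:R^-1 in q_ge qsE.
have k0 : 0 < k by rewrite invr_gt0.
have sk : 0 <= s%:R * k <= 1.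
  by rewrite mulr_ge0 ?(ltW k0) //= ler_pdivrMr // mul1r ler_nat ltnW.
have pm : p ^+ m <= M / N%:R.
  apply: (@le_trans _ _ (K%:R ^+ m / N%:R ^+ m)).
    rewrite exprMn exprVn ler_wpM2r ?invr_ge0 ?exprn_ge0 ?(ltW NR) //.
    by rewrite lerXn2r ?nnegrE ?ler0n // ler_nat ltnW.
  rewrite ler_pdivrMr ?exprn_gt0 // -[in leRHS](prednK m_gt0) exprSr.
  by rewrite -!mulrA [_ * (_ * N%:R)]mulrCA mulVf ?gt_eqF // mulr1.
have up : 1 - 2 * (s%:R * k) - k <= q s.+1 - q s.
  by rewrite qsE; apply: le_trans (lerB (q_ge _) (lexx _)); rewrite -natr1; lra.
have down : - 1 + 2 * (s%:R * k) - k <= q s.-1 - q s.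
  rewrite qsE; apply: le_trans (lerB (q_ge _) (lexx _)).
  by rewrite -[in s%:R](prednK s_gt0) -natr1; lra.
apply: le_trans (lerD (ler_wpM2l a0 up) (ler_wpM2l b0 down)).
have pk : p * k <= N%:R^-1.
  by rewrite /p mulrAC ler_piMl ?invr_ge0 ?(ltW NR) //; case/andP: sk.
have Cpm : C * p ^+ m <= C * M / N%:R by rewrite -mulrA ler_wpM2l.
have drift : (h - p) * (1 - 2 * (s%:R * k)) >= - (C * M / N%:R).
  have : 0 <= h - p <= C * M / N%:R by apply/andP; lra.
  by case/andP: sk => ? ? /andP[? ?]; nra.
have spread : (h * (1 - p) + p * (1 - h)) * k <= (2 + C) / N%:R.
  apply: (@le_trans _ _ ((2 + C) * (p * k))); last first.
    by rewrite ler_wpM2l // addr_ge0.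
  rewrite mulrA ler_wpM2r ?(ltW k0) //.
  have : C * p ^+ m <= C * p by rewrite ler_wpM2l.
  have : 0 <= h * p by rewrite mulr_ge0 // (le_trans p0).
  lra.
by rewrite !mulrDl in spread *; lra.
Qed.

(** The hump of width K = 2 s peaks at s, with height s/2. *)
Lemma mean_time_from_ge_hump (s : nat) (M : R) x :
  0 <= C -> (0 < m)%N -> (0 < s)%N -> (s.*2 <= N)%N ->
  s.*2%:R ^+ m <= M * N%:R ^+ m.-1 -> num_ones x = s ->
  (survival R f x @ \oo --> (0 : R))%classic ->
  ((N%:R * s%:R / (2 * (C * M + 2 + C)))%:E <= mean_time_from R f x)%E.
Proof.
move=> C0 m_gt0 s_gt0 sN KM xs surv.
have K_gt0 : (0 < s.*2)%N by rewrite double_gt0.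
have NR : 0 < N%:R :> R by rewrite ltr0n.
have M0 : 0 <= M.
  have := le_trans (exprn_ge0 m (ler0n R s.*2)) KM.
  by rewrite pmulr_lge0 // exprn_gt0.
have k0 : 0 < C * M + 2 + C by rewrite ltr_wpDr // ltr_wpDl // mulr_ge0.
pose q t : R := Num.max 0 (t%:R - t%:R ^+ 2 / s.*2%:R).
pose k := N%:R / (C * M + 2 + C).
have -> : N%:R * s%:R / (2 * (C * M + 2 + C)) = k * q (num_ones x).
  have sR : 0 < s%:R :> R by rewrite ltr0n.
  rewrite xs /q -muln2 natrM (_ : _ - _ = s%:R / 2); last by field; lra.
  rewrite max_r ?divr_ge0 // /k; field; lra.
have k_ge0 : 0 <= k by rewrite divr_ge0 // ltW.
apply: (mean_time_from_ge (u := fun y => k * q (num_ones y)) (M := k * N%:R)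
   N_gt0) surv => [y|y|y y_nc].
- rewrite ler_wpM2l // /q ge_max ler0n /=.
  apply: (@le_trans _ _ (num_ones y)%:R).
    by rewrite lerBlDr lerDl divr_ge0 ?exprn_ge0.
  by rewrite ler_nat num_ones_le.
- rewrite consensusE => yN; rewrite (_ : q _ = 0) ?mulr0 //.
  apply/max_idPl; case/orP: yN => /eqP ->; first by rewrite expr0n mul0r subrr.
  rewrite subr_le0 ler_pdivlMr ?ltr0n // expr2 ler_wpM2l //.
  by rewrite ler_nat.
rewrite (average_num_ones f N_gt0 (fun t => k * q t)) -!mulrBr lerD2l.
have := hump_drift_ge (q := q) C0 (num_ones_interior y_nc) m_gt0 K_gt0 KM
  (adoptP y) (fun=> erefl).
move=> /(ler_wpM2l k_ge0).
rewrite /density; set P := _%:R / _; set h := adopt_prob _ _ _.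
rewrite (_ : k * - _ = -1); last by rewrite /k; field; lra.
by move=> /le_trans; apply; rewrite le_eqVlt; apply/orP; left; apply/eqP; ring.
Qed.

End BirthDeath.

(** * Sums of inverse powers *)

Section SumBounds.
Variable R : realType.

(** Convexity of the power between x = 0 and x = 1, in a weakened form. *)
Lemma exprD1_le (x : R) n : 0 <= x <= 1 -> (1 + x) ^+ n <= 1 + 2 ^+ n * x.
Proof.
move=> /andP[x0 x1].
suff : (1 + x) ^+ n <= 1 + (2 ^+ n - 1) * x by move/le_trans; apply; nra.
elim: n => [|n IHn]; first by rewrite !expr0 subrr mul0r addr0.
rewrite !exprS; apply: le_trans (ler_wpM2l _ IHn) _; first by rewrite addr_ge0.
have : 1 <= 2 ^+ n :> R by rewrite exprn_ege1 // ler1n.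
have : 0 <= x * (1 - x) by rewrite mulr_ge0 // subr_ge0.
nra.
Qed.

(** Since N^(3/2) = O(N^(2-1/m)), this crude bound on the harmonic sum
    suffices and avoids logarithms. *)
Lemma harmonic_le_sqrt n :
  \sum_(0 <= l < n) l.+1%:R^-1 <= 2 * Num.sqrt n%:R :> R.
Proof.
elim: n => [|n IHn]; first by rewrite big_geq // mulr_ge0 // sqrtr_ge0.
rewrite big_nat_recr //=; apply: le_trans (lerD IHn (lexx _)) _.
have := sqr_sqrtr (ler0n R n); have := sqr_sqrtr (ler0n R n.+1).
have := sqrtr_ge0 (n%:R : R); have : 1 <= Num.sqrt (n.+1%:R : R).
  by rewrite -[leLHS]sqrtr1 ler_wsqrtr // ler1n.
set a := Num.sqrt n.+1%:R; set b := Num.sqrt n%:R => a1 b0 a2 b2.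
rewrite -a2; have a0 : a != 0 by rewrite gt_eqF //; lra.
have ab : a ^+ 2 - b ^+ 2 = 1 by rewrite a2 b2 -natr1; ring.
have ba : b <= a by nra.
rewrite -(ler_pM2r (x := a ^+ 2)) ?exprn_gt0 //; last lra.
rewrite mulrDl mulVf ?expf_neq0 //.
have : 0 <= (a - b) * (2 * a ^+ 2 - a - b) by rewrite mulr_ge0; nra.
rewrite 2!expr2 in ab *; lra.
Qed.

(** For k >= K the term is at most K^(2-m) k^-2, and k^-2 is at most the
    telescoping 2 (1/k - 1/(k+1)). *)
Lemma sum_inv_exp_le K m n : (0 < K)%N -> (2 <= m)%N ->
  \sum_(K <= k < n) k%:R ^- m <= 2 * K%:R / K%:R ^+ m :> R.
Proof.
move=> K0 m2; have KR : 0 < K%:R :> R by rewrite ltr0n.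
have tele k : (K <= k)%N ->
    (k%:R ^- m : R) <= 2 * K%:R ^+ 2 / K%:R ^+ m * (k%:R^-1 - k.+1%:R^-1).
  move=> Kk; have k0 : 0 < k%:R :> R by rewrite ltr0n (leq_trans K0).
  have E : m = ((m - 2) + 2)%N by rewrite subnK.
  have -> : k%:R ^- m = k%:R ^- (m - 2) * k%:R ^- 2 :> R.
    by rewrite {1}E exprD invfM.
  have -> : 2 * K%:R ^+ 2 / K%:R ^+ m = K%:R ^- (m - 2) * 2 :> R.
    rewrite {1}E exprD; field; rewrite expf_neq0 ?gt_eqF //=.
  rewrite -mulrA; apply: ler_pM.
  - by rewrite invr_ge0 exprn_ge0.
  - by rewrite invr_ge0 exprn_ge0.
  - by rewrite lef_pV2 ?posrE ?exprn_gt0 // lerXn2r ?nnegrE ?ler_nat // ltW.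
  have k1 : 1 <= k%:R :> R by rewrite ler1n (leq_trans K0).
  have -> : 2 * (k%:R^-1 - k.+1%:R^-1) = 2 / (k%:R * (k%:R + 1)) :> R.
    by rewrite -natr1; field; lra.
  rewrite ler_pdivlMr; last by apply: mulr_gt0; lra.
  by rewrite ler_pdivrMl ?exprn_gt0 // expr2; nra.
apply: (@le_trans _ _ (\sum_(K <= k < n)
    2 * K%:R ^+ 2 / K%:R ^+ m * (k%:R^-1 - k.+1%:R^-1))).
  by apply: ler_sum_nat => k /andP[Kk _]; exact: tele.
have [Kn|nK] := leqP K n; last first.
  by rewrite big_geq ?(ltnW nK) // !mulr_ge0 ?invr_ge0 ?exprn_ge0.
rewrite -mulr_sumr (telescope_sumr_eq (fun k => - k%:R^-1 : R)) //; last first.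
  by move=> k _; rewrite opprK addrC.
have -> : 2 * K%:R / K%:R ^+ m = 2 * K%:R ^+ 2 / K%:R ^+ m / K%:R :> R.
  by field; rewrite expf_neq0 ?gt_eqF.
rewrite ler_wpM2l ?divr_ge0 ?mulr_ge0 ?exprn_ge0 //.
by rewrite opprK gerDr oppr_le0 invr_ge0.
Qed.

Lemma sum_tails n (F : nat -> R) :
  \sum_(0 <= k < n) \sum_(k <= l < n) F l = \sum_(0 <= l < n) l.+1%:R * F l.
Proof.
elim: n => [|n IHn]; first by rewrite !big_geq.
rewrite [RHS]big_nat_recr //= -IHn big_nat_recr //= big_nat1.
rewrite (eq_big_nat _ _ (F2 := fun k => \sum_(k <= l < n) F l + F n)).
  by rewrite big_split /= sumr_const_nat subn0 -addrA -mulrSr mulr_natl.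
by move=> k /andP[_ kn]; rewrite big_nat_recr // ltnW.
Qed.

End SumBounds.

(** * The supersolution *)

(** K is N^((m-1)/m) up to a constant factor; working with an integer keeps
    the comparisons below between natural numbers. *)
Lemma threshold_exists N m A : (2 <= N)%N -> (2 <= m)%N -> (0 < A)%N ->
  exists2 K, (A * K ^ m <= N ^ m.-1)%N & (N ^ m.-1 < A * K.+1 ^ m)%N.
Proof.
move=> N_gt1 m_gt1 A0.
have ex : exists k, (N ^ m.-1 < A * k ^ m)%N.
  exists N; apply: (@leq_trans (N ^ m)); last exact: leq_pmull.
  by rewrite ltn_exp2l // prednK //; lia.
case: (ex_minnP ex) => -[|K] KP Kmin.
  by rewrite exp0n ?muln0 // in KP; lia.
exists K => //; rewrite leqNgt; apply/negP => /Kmin.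
by rewrite ltnn.
Qed.

(** The constants are chosen from the bottom up: A makes the drift negligible
    below K, D makes it dominate above K2 = D (K + 1), and B makes the second
    sequence larger than the first one up to K2. *)
Section Profile.
Variables (N m C : nat).
Hypotheses (N_gt1 : (2 <= N)%N) (m_gt1 : (2 <= m)%N) (C_gt0 : (0 < C)%N).

Let A := (2 ^ m * C)%N.
Let D := (2 ^ m.+2 * A)%N.
Let B := ((2 * D) ^ m.+1)%N.
Variable K : nat.
Hypothesis K_le : (A * K ^ m <= N ^ m.-1)%N.

Let m_gt0 : (0 < m)%N. Proof. by lia. Qed.
Let A_gt0 : (0 < A)%N. Proof. by rewrite muln_gt0 expn_gt0. Qed.
Let D_gt0 : (0 < D)%N. Proof. by rewrite muln_gt0 expn_gt0. Qed.

Let K_half : (2 * K <= N)%N.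
Proof.
rewrite -(leq_exp2r _ _ m_gt0) expnMn.
apply: (@leq_trans (N ^ m.-1)).
  by apply: leq_trans K_le; rewrite /A leq_mul2r leq_pmulr ?orbT.
by rewrite leq_pexp2l ?leq_pred //; lia.
Qed.

Let ltn_K_N l : (l < K)%N -> (l < N)%N.
Proof.
by move=> lK; apply: leq_trans lK (leq_trans _ K_half); rewrite leq_pmull.
Qed.

Lemma threshold_succ_le : (K.+1 ^ m <= 2 ^ m * N ^ m.-1)%N.
Proof.
have [->|K0] := posnP K.
  by rewrite exp1n muln_gt0 !expn_gt0 (leq_trans _ N_gt1).
apply: (@leq_trans ((2 * K) ^ m)); first by rewrite leq_exp2r //; lia.
rewrite expnMn leq_mul2l; apply/orP; right.
by apply: leq_trans K_le; rewrite leq_pmull.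
Qed.

Variable R : realType.
Hypothesis K_ge : (N ^ m.-1 < A * K.+1 ^ m)%N.
Let K2 := (D * K.+1)%N.

Let NR : 0 < N%:R :> R. Proof. by rewrite ltr0n; lia. Qed.

(** At p = l/N this is 2 / (p (1 - p)): the increment of w that pays for two
    units of time through up-moves, whose probability is at least p (1 -
    p). *)
Let e (l : nat) : R := 2 * N%:R ^+ 2 / (l%:R * (N%:R - l%:R)).

(** [w1] changes sign at K, so that u increases up to K and decreases
    afterwards: below K the walk is likely to be absorbed at 0, which shortens
    T. *)
Let w1 (s : nat) : R :=
  \sum_(0 <= l < s) e l.+1 - \sum_(0 <= l < K) e l.+1.

(** Up to the factor B this is the inverse of the least possible drift. *)
Let w2 (s : nat) : R :=
  B%:R * (N%:R / s%:R) ^+ m * (N%:R / (N%:R - s%:R)).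

Let Nsub_gt0 s : (s < N)%N -> 0 < N%:R - s%:R :> R.
Proof. by move=> sN; rewrite subr_gt0 ltr_nat. Qed.

Let e_ge0 l : (l < N)%N -> 0 <= e l.+1.
Proof.
by move=> lN; rewrite /e !mulr_ge0 ?invr_ge0 ?mulr_ge0 // subr_ge0 ler_nat.
Qed.

Let e_half l : (l < K)%N -> e l.+1 <= 4 * N%:R * l.+1%:R^-1.
Proof.
move=> lK; have l0 : 0 < l.+1%:R :> R by rewrite ltr0n.
have lN : (2 * l.+1 <= N)%N by lia.
have lN' : 2 * l.+1%:R <= N%:R :> R by rewrite -natrM ler_nat.
rewrite /e ler_pdivrMr; last by rewrite mulr_gt0 ?Nsub_gt0 //; lia.
have -> : 4 * N%:R * l.+1%:R^-1 *
  (l.+1%:R * (N%:R - l.+1%:R)) = 4 * N%:R * (N%:R - l.+1%:R) :> R.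
  by field; lra.
nra.
Qed.

Let w1_below s : (s <= K)%N -> w1 s = - \sum_(s <= l < K) e l.+1.
Proof.
by move=> sK; rewrite /w1 [X in _ - X](big_cat_nat (n := s)) //=; ring.
Qed.

Let w1_above s : (K <= s)%N -> w1 s = \sum_(K <= l < s) e l.+1.
Proof. by move=> sK; rewrite /w1 (big_cat_nat (n := K)) //=; ring. Qed.

Let w2_ge0 s : (s < N)%N -> 0 <= w2 s.
Proof.
move=> sN; rewrite /w2 !mulr_ge0 ?exprn_ge0 ?divr_ge0 //.
by rewrite invr_ge0 ltW ?Nsub_gt0.
Qed.

Let w1_le0 s : (s <= K)%N -> w1 s <= 0.
Proof.
move=> sK; rewrite w1_below // oppr_le0 big_nat_cond sumr_ge0 // => l.
by rewrite andbT => /andP[_ lK]; exact/e_ge0/ltn_K_N.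
Qed.

Let w1_bound s : (s < N)%N -> (s <= K2)%N ->
  w1 s <= 2 * D%:R * N%:R ^+ 2 / (N%:R - s%:R).
Proof.
move=> sN sK2; have Ns := Nsub_gt0 sN.
have [sK|Ks] := leqP s K.
  apply: le_trans (w1_le0 sK) _.
  by rewrite divr_ge0 ?mulr_ge0 ?exprn_ge0 ?(ltW Ns).
rewrite w1_above ?(ltnW Ks) //.
apply: (@le_trans _ _ (\sum_(K <= l < s)
    2 * N%:R ^+ 2 / (K.+1%:R * (N%:R - s%:R)))).
  apply: ler_sum_nat => l /andP[Kl ls].
  rewrite ler_wpM2l ?mulr_ge0 ?exprn_ge0 // lef_pV2 ?posrE; first last.
  - by rewrite mulr_gt0.
  - by rewrite mulr_gt0 // Nsub_gt0 //; lia.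
  by rewrite ler_pM ?(ltW Ns) // ?lerD2l ?lerN2 ler_nat.
rewrite sumr_const_nat -[leLHS]mulr_natl.
have K0 : 0 < K.+1%:R :> R by rewrite ltr0n.
have -> : 2 * D%:R * N%:R ^+ 2 / (N%:R - s%:R) =
    (D * K.+1)%:R * (2 * N%:R ^+ 2 / (K.+1%:R * (N%:R - s%:R))) :> R.
  by rewrite natrM; field; rewrite !gt_eqF.
rewrite ler_wpM2r ?divr_ge0 ?mulr_ge0 ?exprn_ge0 ?(ltW Ns) //.
by rewrite ler_nat /K2 in sK2 *; lia.
Qed.

Let w1_le_w2 s : (0 < s < N)%N -> (s <= K2)%N -> w1 s <= w2 s.
Proof.
move=> /andP[s0 sN] sK2; have Ns := Nsub_gt0 sN.
have sR : 0 < s%:R :> R by rewrite ltr0n.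
apply: le_trans (w1_bound sN sK2) _.
rewrite /w2 mulrA ler_wpM2r ?invr_ge0 ?(ltW Ns) // expr2 mulrA.
rewrite ler_wpM2r ?(ltW NR) // expr_div_n mulrA ler_pdivlMr ?exprn_gt0 //.
have -> : N%:R ^+ m = N%:R * N%:R ^+ m.-1 :> R by rewrite -exprS prednK.
rewrite -!natrX -!natrM ler_nat.
have sm : (s ^ m <= (2 * D) ^ m * N ^ m.-1)%N.
  apply: (@leq_trans (K2 ^ m)); first by rewrite leq_exp2r.
  rewrite /K2 (expnMn D) (expnMn 2) [(2 ^ m * _)%N]mulnC -mulnA leq_mul2l.
  by rewrite threshold_succ_le orbT.
apply: leq_trans (leq_mul (leqnn _) sm) _.
by rewrite /B expnS; apply/eq_leq; ring.
Qed.

Let K2_large : (2 ^ m.+2 * N ^ m.-1 <= K2 ^ m)%N.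
Proof.
rewrite /K2 (expnMn D); apply: (@leq_trans (D * K.+1 ^ m)%N).
  by rewrite /D -mulnA leq_mul2l ltnW ?orbT.
by rewrite leq_mul2r -[X in (X <= _)%N]expn1 leq_pexp2l ?orbT.
Qed.

(** The truncation to the smaller sequence keeps the sum of |w| small: [w1]
    alone would give at least the order N^2, and [w2] is too large below the
    scale. *)
Definition profile k : R := Num.min (w1 k) (w2 k).

Section OneStep.
Variables (s : nat) (h : R).
Hypothesis s_int : (0 < s < N)%N.
Let p : R := s%:R / N%:R.
Hypothesis h_adm : admissible m C%:R p h.

Let s_gt0 : (0 < s)%N. Proof. by case/andP: s_int. Qed.
Let sN : (s < N)%N. Proof. by case/andP: s_int. Qed.
Let Ns : 0 < N%:R - s%:R :> R. Proof. exact: Nsub_gt0. Qed.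
Let sR : 0 < s%:R :> R. Proof. by rewrite ltr0n. Qed.
Let p_gt0 : 0 < p. Proof. by rewrite divr_gt0. Qed.
Let p_lt1 : p < 1. Proof. by rewrite ltr_pdivrMr // mul1r ltr_nat. Qed.
Let oneBp : 1 - p = (N%:R - s%:R) / N%:R.
Proof. by rewrite mulrBl divff ?gt_eqF. Qed.
Let pm_gt0 : 0 < p ^+ m. Proof. by rewrite exprn_gt0. Qed.

(* Where w1 >= 0 the drift helps. Below K it costs at most 1 of the 2 units
   paid by the increment, because |w1(s - 1)| <= 4 N K / s and A K^m <=
   N^(m-1). *)
Let w1_step : 1 <= (1 - p) * h * w1 s - p * (1 - h) * w1 s.-1.
Proof.
have [h_ge h_le h_le1] := h_adm.
have hp : p <= h.
  apply: le_trans h_ge.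
  by rewrite lerDl mulr_ge0 ?(ltW pm_gt0) // subr_ge0 ltW.
have w1S : w1 s = w1 s.-1 + e s.
  by rewrite /w1 -{1 3}(prednK s_gt0) big_nat_recr //=; ring.
have ae : 2 <= (1 - p) * h * e s.
  have -> : 2 = (1 - p) * p * e s.
    by rewrite oneBp /p /e; field; rewrite !gt_eqF.
  rewrite ler_wpM2r //.
    by rewrite -(prednK s_gt0) e_ge0 // (leq_ltn_trans (leq_pred _)).
  by rewrite ler_wpM2l // subr_ge0 ltW.
suff : -1 <= (h - p) * w1 s.-1 by rewrite w1S; lra.
have [Ks|sK] := leqP K s.-1.
  apply: (@le_trans _ _ 0) => //; apply: mulr_ge0; first by rewrite subr_ge0.
  rewrite w1_above //.
  rewrite big_nat_cond sumr_ge0 // => l; rewrite andbT => /andP[_ ls].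
  exact/e_ge0/(leq_trans ls)/(leq_trans (leq_pred _))/ltnW.
rewrite w1_below ?(ltnW sK) // mulrN lerN2.
apply: (@le_trans _ _ (C%:R * p ^+ m * (4 * N%:R * K%:R / s%:R))).
  apply: ler_pM; rewrite ?subr_ge0 //; last 2 first.
  - by rewrite lerBlDl.
  - apply: (@le_trans _ _ (\sum_(s.-1 <= l < K) 4 * N%:R / s%:R)).
      apply: ler_sum_nat => l /andP[sl lK]; apply: le_trans (e_half lK) _.
      rewrite ler_wpM2l ?mulr_ge0 // lef_pV2 ?posrE ?ltr0n // ler_nat.
      by rewrite -(prednK s_gt0).
    rewrite sumr_const_nat -[leLHS]mulr_natl [leRHS]mulrAC [leRHS]mulrC.
    by rewrite ler_wpM2r ?divr_ge0 ?mulr_ge0 // ler_nat leq_subr.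
  rewrite big_nat_cond sumr_ge0 // => l; rewrite andbT => /andP[_ ls].
  exact/e_ge0/ltn_K_N.
have -> : C%:R * p ^+ m * (4 * N%:R * K%:R / s%:R) =
    4 * C%:R * K%:R * p ^+ m.-1 :> R.
  rewrite -[in LHS](prednK m_gt0) exprS {1}/p; field; rewrite !gt_eqF //.
rewrite expr_div_n mulrA ler_pdivrMr ?exprn_gt0 // mul1r.
rewrite -!natrX -!natrM ler_nat; apply: leq_trans K_le.
have -> : (K ^ m = K * K ^ m.-1)%N by rewrite -expnS prednK.
rewrite mulnA leq_mul //; last first.
  by rewrite leq_exp2r; [rewrite -(prednK s_gt0) | rewrite -ltnS prednK].
rewrite leq_mul2r /A leq_mul2r; apply/orP; right; apply/orP; right.
by rewrite -[4%N]/(2 ^ 2)%N leq_exp2l.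
Qed.

(* The drift pays B per step, and the decrease of w2 between s - 1 and s costs
   at most B/2 once s^m >= 2^(m+2) N^(m-1). *)
Let w2_step : (K2 <= s)%N -> 1 <= (1 - p) * h * w2 s - p * (1 - h) * w2 s.-1.
Proof.
move=> K2s; have [h_ge h_le h_le1] := h_adm.
have D4 : (4 <= D)%N.
  rewrite /D; apply: leq_trans (leq_pmulr _ A_gt0).
  by rewrite -[4%N]/(2 ^ 2)%N leq_exp2l.
have s_ge2 : (2 <= s)%N.
  apply: leq_trans K2s.
  by rewrite /K2 (leq_trans _ (leq_pmulr _ _)) // ltnW // ltnW.
have s_large : 2 ^+ m.+2 * N%:R ^+ m.-1 <= s%:R ^+ m :> R.
  by rewrite -!natrX -natrM ler_nat (leq_trans K2_large) // leq_exp2r.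
pose q : R := s.-1%:R; pose v := p ^+ m.
have q0 : 0 < q by rewrite ltr0n -ltnS prednK.
have sq : s%:R = q + 1 by rewrite /q natr1 prednK.
have hv : (1 - h) <= (1 - p) * (1 - v) by rewrite -/v in h_ge; lra.
have v0 : 0 < v by [].
have v1 : v <= 1 by rewrite exprn_ile1 // ltW.
have up : (1 - p) * h * w2 s = h * (B%:R / v).
  rewrite /w2 /v /p oneBp -[N%:R / s%:R]invf_div exprVn; field.
  by rewrite !gt_eqF ?expf_neq0.
have down : p * (1 - h) * w2 s.-1 <= p * (1 - v) * (B%:R * (N%:R / q) ^+ m).
  apply: (@le_trans _ _ (p * ((1 - p) * (1 - v)) * (B%:R * (N%:R / q) ^+ m *
      (N%:R / (N%:R - s%:R))))).
    apply: ler_pM.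
    - by rewrite mulr_ge0 ?(ltW p_gt0) // subr_ge0.
    - exact/w2_ge0/(leq_ltn_trans (leq_pred _)).
    - by rewrite ler_wpM2l // ltW.
    rewrite /w2 ler_wpM2l ?mulr_ge0 ?exprn_ge0 ?divr_ge0 ?(ltW q0) //.
    rewrite ler_wpM2l // lef_pV2 ?posrE ?Nsub_gt0 //.
      2: exact: leq_ltn_trans (leq_pred _) sN.
    by rewrite lerD2l lerN2 ler_nat leq_pred.
  rewrite oneBp le_eqVlt; apply/orP; left; apply/eqP; field.
  by rewrite !gt_eqF.
apply: le_trans (lerB (lexx _) down); rewrite up.
(* With N/(s - 1) = (1 + 1/(s - 1)) / p, and then 1/(s - 1) <= 2/s. *)
have drop : (N%:R / q) ^+ m <= v^-1 * (1 + 2 ^+ m.+1 / s%:R).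
  have -> : N%:R / q = p^-1 * (1 + q^-1).
    by rewrite /p sq; field; rewrite !gt_eqF //; lra.
  rewrite exprMn exprVn ler_wpM2l ?invr_ge0 ?(ltW v0) //.
  have q1 : 1 <= q by rewrite ler1n -ltnS prednK.
  apply: le_trans (exprD1_le _ _) _.
    by rewrite invr_ge0 (ltW q0) /= invf_le1.
  rewrite lerD2l exprSr -mulrA ler_wpM2l ?exprn_ge0 //.
  by rewrite ler_pdivlMr // mulrC ler_pdivrMr // sq; lra.
have small : p / v * (2 ^+ m.+1 / s%:R) <= 1 / 2.
  have -> : p / v * (2 ^+ m.+1 / s%:R) = 2 ^+ m.+1 * N%:R ^+ m.-1 / s%:R ^+ m.
    have Nm : N%:R ^+ m = N%:R * N%:R ^+ m.-1 :> R by rewrite -exprS prednK.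
    rewrite /v /p expr_div_n Nm; field.
    by rewrite !gt_eqF ?exprn_gt0.
  rewrite ler_pdivrMr ?exprn_gt0 //.
  by move: s_large; rewrite [2 ^+ m.+2]exprS; lra.
have h_v : p / v + (1 - p) <= h / v.
  rewrite ler_pdivlMr // mulrDl divfK ?gt_eqF //.
have B2 : 2 <= B%:R :> R.
  rewrite ler_nat /B expnS -mulnA leq_pmulr // muln_gt0 D_gt0 expn_gt0.
  by rewrite muln_gt0 D_gt0.
have main : 1 / 2 <= h / v - p * (1 - v) * (N%:R / q) ^+ m.
  have : p * (1 - v) * (N%:R / q) ^+ m <=
      p * (1 - v) * (v^-1 * (1 + 2 ^+ m.+1 / s%:R)).
    by rewrite ler_wpM2l // mulr_ge0 ?(ltW p_gt0) // subr_ge0.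
  have -> : p * (1 - v) * (v^-1 * (1 + 2 ^+ m.+1 / s%:R)) =
      p / v - p + (1 - v) * (p / v * (2 ^+ m.+1 / s%:R)).
    by field; rewrite !gt_eqF.
  have : (1 - v) * (p / v * (2 ^+ m.+1 / s%:R)) <= p / v * (2 ^+ m.+1 / s%:R).
    rewrite ler_piMl //; last lra.
    by rewrite !mulr_ge0 ?invr_ge0 ?exprn_ge0 ?(ltW v0) ?(ltW p_gt0).
  lra.
have -> : h * (B%:R / v) - p * (1 - v) * (B%:R * (N%:R / q) ^+ m) =
   B%:R * (h / v - p * (1 - v) * (N%:R / q) ^+ m) by ring.
nra.
Qed.

Lemma profile_step :
  1 <= (1 - p) * h * profile s - p * (1 - h) * profile s.-1.
Proof.
have [h_ge h_le h_le1] := h_adm.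
have b_ge0 : 0 <= p * (1 - h).
  by rewrite mulr_ge0 ?(ltW p_gt0) ?subr_ge0.
rewrite [profile s]/profile; case: (leP (w1 s) (w2 s)) => [_|w21].
  apply: le_trans w1_step _; rewrite lerD2l lerN2 ler_wpM2l //.
  by rewrite ge_min lexx.
have K2s : (K2 <= s)%N.
  rewrite leqNgt; apply/negP => /ltnW/(w1_le_w2 s_int).
  by rewrite leNgt w21.
apply: le_trans (w2_step K2s) _; rewrite lerD2l lerN2 ler_wpM2l //.
by rewrite ge_min lexx orbT.
Qed.

End OneStep.

Let profile_below k : (k < K)%N ->
  `|profile k| <= 4 * N%:R * \sum_(k <= l < K) l.+1%:R^-1.
Proof.
move=> kK; have kN := ltn_K_N kK; have w1k := w1_le0 (ltnW kK).
rewrite /profile min_l ?(le_trans w1k) ?w2_ge0 // ler0_norm //.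
rewrite w1_below ?(ltnW kK) //.
rewrite opprK mulr_sumr; apply: ler_sum_nat => l /andP[_ lK]; exact: e_half.
Qed.

(* The first two terms serve 2 k <= N, on either side of K2; the third serves
   2 k > N, where the factor N/(N - k) of w2 can be large. *)
Let profile_above k : (K <= k < N)%N ->
  `|profile k| <= (if (k < K2)%N then 4 * D%:R * N%:R else 0)
    + ((if (K2 <= k)%N then 2 * B%:R * N%:R ^+ m * k%:R ^- m else 0)
       + 2 ^+ m * B%:R * N%:R * (N%:R - k%:R)^-1).
Proof.
move=> /andP[Kk kN]; have Nk := Nsub_gt0 kN.
have w1k : 0 <= w1 k.
  rewrite w1_above // big_nat_cond sumr_ge0 // => l.
  by rewrite andbT => /andP[_ lk]; exact/e_ge0/(ltn_trans lk).
rewrite ger0_norm ?le_min ?w1k ?w2_ge0 //.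
have g2 : 0 <= (if (k < K2)%N then 4 * D%:R * N%:R else 0) :> R.
  by case: ifP => // _; rewrite !mulr_ge0.
have g3 : 0 <= (if (K2 <= k)%N
    then 2 * B%:R * N%:R ^+ m * k%:R ^- m else 0) :> R.
  by case: ifP => // _; rewrite !mulr_ge0 ?invr_ge0 ?exprn_ge0.
have g4 : 0 <= 2 ^+ m * B%:R * N%:R * (N%:R - k%:R)^-1 :> R.
  by rewrite !mulr_ge0 ?invr_ge0 ?exprn_ge0 // ltW.
have [k2N|Nk2] := leqP (2 * k) N; last first.
  apply: (@le_trans _ _ (2 ^+ m * B%:R * N%:R * (N%:R - k%:R)^-1)).
    2: by rewrite addrA lerDr addr_ge0.
  rewrite ge_min; apply/orP; right.
  rewrite /w2 mulrA ler_wpM2r ?invr_ge0 ?(ltW Nk) // ler_wpM2r // mulrC.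
  rewrite ler_wpM2r // lerXn2r ?nnegrE ?divr_ge0 //.
  rewrite ler_pdivrMr ?ltr0n; first by rewrite -natrM ler_nat ltnW.
  by move: Nk2; case: (k) => //; rewrite muln0.
have Nk_half : N%:R / (N%:R - k%:R) <= 2 :> R.
  rewrite ler_pdivrMr //; have : (2 * k)%:R <= N%:R :> R by rewrite ler_nat.
  rewrite natrM; lra.
move: g2 g3; have [kK2|K2k] := ltnP k K2 => /= g2 g3.
  apply: (@le_trans _ _ (4 * D%:R * N%:R)); last first.
    by rewrite lerDl addr_ge0.
  rewrite ge_min; apply/orP; left.
  apply: le_trans (w1_bound kN (ltnW kK2)) _.
  have -> : 4 * D%:R * N%:R = 2 * D%:R * N%:R * 2 :> R by ring.
  by rewrite expr2 !mulrA -mulrA ler_wpM2l ?mulr_ge0.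
apply: (@le_trans _ _ (2 * B%:R * N%:R ^+ m * k%:R ^- m)); last first.
  by rewrite addrCA lerDl addr_ge0.
rewrite ge_min; apply/orP; right; rewrite /w2 expr_div_n.
have -> : 2 * B%:R * N%:R ^+ m * k%:R ^- m =
  B%:R * (N%:R ^+ m / k%:R ^+ m) * 2 :> R by ring.
by rewrite ler_wpM2l // mulr_ge0 // divr_ge0 ?exprn_ge0.
Qed.

(* Exchanging the sums, 1/(l + 1) is counted l + 1 times. *)
Let sum_below : \sum_(0 <= k < K) `|profile k| <= 4 * N%:R * K%:R.
Proof.
apply: (@le_trans _ _ (\sum_(0 <= k < K)
    4 * N%:R * \sum_(k <= l < K) l.+1%:R^-1)).
  by apply: ler_sum_nat => k /andP[_ kK]; exact: profile_below.
rewrite -mulr_sumr sum_tails ler_wpM2l ?mulr_ge0 //.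
rewrite (eq_bigr (fun=> 1)) => [|l _]; last by rewrite mulfV // pnatr_eq0.
by rewrite sumr_const_nat subn0.
Qed.

Let sum_power : \sum_(K2 <= k < N) 2 * B%:R * N%:R ^+ m * k%:R ^- m
  <= 4 * B%:R * N%:R * K2%:R :> R.
Proof.
have K2_gt0 : (0 < K2)%N by rewrite muln_gt0 D_gt0.
have K2R : 0 < K2%:R :> R by rewrite ltr0n.
rewrite -mulr_sumr.
apply: le_trans (ler_wpM2l _ (sum_inv_exp_le _ _ K2_gt0 m_gt1)) _.
  by rewrite !mulr_ge0 ?exprn_ge0.
have Nm : N%:R ^+ m = N%:R * N%:R ^+ m.-1 :> R by rewrite -exprS prednK.
have -> : 2 * B%:R * N%:R ^+ m * (2 * K2%:R / K2%:R ^+ m) =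
    4 * B%:R * N%:R * K2%:R * (N%:R ^+ m.-1 / K2%:R ^+ m) :> R.
  by rewrite Nm; ring.
rewrite ler_piMr ?mulr_ge0 // ler_pdivrMr ?exprn_gt0 // mul1r.
rewrite -!natrX ler_nat; apply: leq_trans K2_large.
by rewrite leq_pmull // expn_gt0.
Qed.

Lemma profile_sum_le : \sum_(0 <= k < N) `|profile k| <=
  N%:R * ((4 + 4 * D%:R ^+ 2 + 4 * B%:R * D%:R) * K.+1%:R
          + 2 ^+ m.+1 * B%:R * Num.sqrt N%:R).
Proof.
have KN : (K <= N)%N by apply: leq_trans K_half; rewrite leq_pmull.
rewrite (big_cat_nat (n := K)) //=.
have above : \sum_(K <= k < N) `|profile k| <=
    4 * D%:R * N%:R * K2%:R + (4 * B%:R * N%:R * K2%:R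
      + 2 ^+ m * B%:R * N%:R * (2 * Num.sqrt N%:R)).
  apply: (@le_trans _ _ (\sum_(0 <= k < N)
    ((if (k < K2)%N then 4 * D%:R * N%:R else 0)
    + ((if (K2 <= k)%N then 2 * B%:R * N%:R ^+ m * k%:R ^- m else 0)
       + 2 ^+ m * B%:R * N%:R * (N%:R - k%:R)^-1)))).
    rewrite [leRHS](big_cat_nat (n := K)) //=; apply: ler_wpDl; last first.
      by apply: ler_sum_nat => k; exact: profile_above.
    rewrite big_nat_cond sumr_ge0 // => k; rewrite andbT => /andP[_ kK].
    have Nk : 0 <= N%:R - k%:R :> R by exact/ltW/Nsub_gt0/ltn_K_N.
    by rewrite !addr_ge0 //; try (case: ifP => // _);
      rewrite !mulr_ge0 ?invr_ge0 ?exprn_ge0.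
  rewrite !big_split /=; apply: lerD; last apply: lerD.
  - rewrite -big_mkcond /=; have [NK2|K2N] := leqP N K2.
      apply: (@le_trans _ _ (\sum_(0 <= k < N) 4 * D%:R * N%:R)).
        rewrite big_mkcond; apply: ler_sum => k _.
        by case: ifP => // _; rewrite !mulr_ge0.
      rewrite sumr_const_nat subn0 -[leLHS]mulr_natr ler_wpM2l ?mulr_ge0 //.
      by rewrite ler_nat.
    rewrite -(big_nat_widen _ _ _ predT) ?(ltnW K2N) //.
    by rewrite sumr_const_nat subn0 -[leLHS]mulr_natr.
  - by rewrite -big_mkcond -(big_nat_widenl _ _ _ predT) //; exact: sum_power.
  rewrite -mulr_sumr ler_wpM2l ?mulr_ge0 ?exprn_ge0 //.
  apply: le_trans (harmonic_le_sqrt R N); rewrite [leLHS]big_nat_rev /= add0n.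
  apply: ler_sum_nat => k /andP[_ kN].
  by rewrite natrB // opprB addrCA subrr addr0.
apply: le_trans (lerD sum_below above) _.
have K_le' : K%:R <= K.+1%:R :> R by rewrite ler_nat.
have : 4 * N%:R * K%:R <= 4 * N%:R * K.+1%:R :> R.
  by rewrite ler_wpM2l ?mulr_ge0.
rewrite /K2 [(D * _)%:R]natrM [2 ^+ m.+1]exprS expr2; lra.
Qed.

End Profile.

(** * Scales and the two-sided bound *)

Section Scales.
Variables (R : realType) (N m : nat).
Hypotheses (N_gt1 : (2 <= N)%N) (m_gt1 : (2 <= m)%N).

Definition scale : R := N%:R `^ ((m%:R - 1) / m%:R).

(** The factor 1/4 makes 2 start_size <= N hold for every N >= 2, so that the
    hump of width 2 start_size fits without a separate treatment of small
    N. *)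
Definition start_size : nat := `|Num.ceil (4^-1 * scale)|%N.

Let mR : 2 <= m%:R :> R. Proof. by rewrite ler_nat. Qed.
Let m_gt0 : 0 < m%:R :> R. Proof. by rewrite ltr0n ltnW. Qed.
Let N_gt0 : 0 < N%:R :> R. Proof. by rewrite ltr0n ltnW. Qed.
Let scale_ge0 : 0 <= scale. Proof. exact: powR_ge0. Qed.

Lemma scaleXm : scale ^+ m = N%:R ^+ m.-1.
Proof.
rewrite -powR_mulrn // -powRrM divfK ?gt_eqF //.
rewrite -powR_mulrn //; congr (_ `^ _).
by rewrite -[in LHS](prednK (n := m)) ?(ltn_trans _ m_gt1) // -natr1 addrK.
Qed.

Lemma mul_scale : N%:R * scale = N%:R `^ (2 - m%:R^-1).
Proof.
rewrite -{1}[N%:R]powRr1 // -powRD; last first.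
  by apply/implyP => _; rewrite gt_eqF.
by congr (_ `^ _); field; rewrite gt_eqF.
Qed.

Lemma le_scale k c : (k ^ m <= c ^ m * N ^ m.-1)%N -> k%:R <= c%:R * scale.
Proof.
move=> km; rewrite -(ler_pXn2r (n := m)) ?nnegrE ?mulr_ge0 //; last by lia.
by rewrite exprMn scaleXm -!natrX -natrM ler_nat.
Qed.

Lemma sqrt_le_scale : Num.sqrt N%:R <= scale.
Proof.
rewrite -powR12_sqrt //; apply: ler_powR; first by rewrite ler1n ltnW.
by rewrite ler_pdivlMr //; move: mR; lra.
Qed.

Let scale_ge1 : 1 <= scale.
Proof.
apply: le_trans sqrt_le_scale.
by rewrite -[leLHS]sqrtr1 ler_wsqrtr // ler1n ltnW.
Qed.

Let scale_le : scale <= N%:R.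
Proof.
rewrite -[leRHS]powRr1 //; apply: ler_powR; first by rewrite ler1n ltnW.
by rewrite ler_pdivrMr //; move: mR; lra.
Qed.

Lemma start_size_itv : 4^-1 * scale <= start_size%:R < 4^-1 * scale + 1.
Proof.
have c0 : (0 <= Num.ceil (4^-1 * scale)).
  by rewrite ceil_ge0; apply: lt_le_trans (mulr_ge0 _ scale_ge0).
rewrite /start_size natr_absz ger0_norm // ceil_ge /=.
have := ceilB1_lt (4^-1 * scale); rewrite intrB; lra.
Qed.

Lemma start_size_gt0 : (0 < start_size)%N.
Proof.
rewrite -(ltr_nat R); case/andP: start_size_itv => + _.
by apply: lt_le_trans; rewrite mulr_gt0 // (lt_le_trans _ scale_ge1).
Qed.

Lemma double_start_size_le : (start_size.*2 <= N)%N.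
Proof.
have : start_size%:R * 4 < (N + 4)%:R :> R.
  by case/andP: start_size_itv => _; rewrite natrD; move: scale_le; lra.
rewrite -natrM ltr_nat -muln2; lia.
Qed.

Lemma double_start_size_expm :
  start_size.*2%:R ^+ m <= 4 ^+ m * N%:R ^+ m.-1 :> R.
Proof.
rewrite -scaleXm -exprMn; apply: lerXn2r; rewrite ?nnegrE ?mulr_ge0 //.
by case/andP: start_size_itv => _; rewrite -muln2 natrM; move: scale_ge1; lra.
Qed.

End Scales.

Lemma num_ones_first_ones N s : (s <= N)%N -> num_ones (first_ones N s) = s.
Proof.
move=> sN; rewrite /num_ones -sum1_card.
rewrite (eq_bigl (fun i : 'I_N => i < s)%N); last first.
  by move=> i; rewrite finset.inE ffunE.
by rewrite (big_ord_narrow sN) sum1_card card_ord.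
Qed.

(** The constants depend on m and r only: K + 1 and the square root of N are
    both at most a constant times the scale. *)
Lemma mean_time_bounds (R : realType) (r : nat) (f : boolean_rule r) (j : 'I_r)
    (m := min_minterm_size (residual f j)) :
  monotone_rule f -> ~ constant_rule f -> ~ dictator f -> D0 f = 1%N ->
  f (basis_vec j) ->
  exists c C : R, [/\ 0 < c, 0 < C & forall N, (2 <= N)%N ->
    [/\ forall s, (1 <= s < N)%N ->
          (mean_time R f N s <= (C * N%:R `^ (2 - m%:R^-1))%:E)%E,
        (1 <= start_size R N m <= N - 1)%N
      & ((c * N%:R `^ (2 - m%:R^-1))%:E
          <= mean_time R f N (start_size R N m))%E]].
Proof.
move=> f_mon f_nc f_nd f_D0 fj.
have m_gt1 : (2 <= m)%N.
  exact: (residual_min_minterm_size_ge2 f_mon f_nc f_nd f_D0 fj).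
pose C0 := (2 ^ r)%N; have C0_gt0 : (0 < C0)%N by rewrite expn_gt0.
pose A := (2 ^ m * C0)%N; pose D := (2 ^ m.+2 * A)%N.
pose B := ((2 * D) ^ m.+1)%N.
pose U : R := (4 + 4 * D%:R ^+ 2 + 4 * B%:R * D%:R) * 2 + 2 ^+ m.+1 * B%:R.
have U_gt0 : 0 < U.
  apply: ltr_pwDl; last by rewrite mulr_ge0 ?exprn_ge0.
  by rewrite pmulr_lgt0 // -addrA ltr_pwDl // addr_ge0 // !mulr_ge0 ?exprn_ge0.
pose d : R := C0%:R * 4 ^+ m + 2 + C0%:R.
have d_gt0 : 0 < d by rewrite ltr_wpDr // ltr_wpDl // mulr_ge0 ?exprn_ge0.
exists (8 * d)^-1, (U *+ 2); split.
- by rewrite invr_gt0 mulr_gt0.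
- by rewrite pmulrn_lgt0.
move=> N N_gt1; have N_gt0 : (0 < N)%N by lia.
have adm (x : state N) : admissible m C0%:R (density R x) (adopt_prob R f x).
  split.
  - exact: adopt_prob_ge.
  - by rewrite /C0 natrX; exact: adopt_prob_le.
  rewrite -(sample_prob1 R r N_gt0).
  exact: ler_sample_prob.
have A_gt0 : (0 < A)%N by rewrite muln_gt0 expn_gt0.
have [K K_le K_ge] := threshold_exists N_gt1 m_gt1 A_gt0.
have tmU (x : state N) n :
    truncated_mean R f x n <= U *+ 2 * (N%:R * scale R N m).
  have := truncated_mean_le_sum N_gt0 adm
    (@profile_step _ _ _ N_gt1 m_gt1 C0_gt0 _ K_le R K_ge) x n.
  move/le_trans; apply.
  rewrite [leRHS]mulrnAl lerMn2r /=.
  apply: le_trans (profile_sum_le N_gt1 m_gt1 C0_gt0 K_le R K_ge) _.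
  rewrite [leRHS]mulrCA ler_wpM2l // [leRHS]mulrDl lerD //.
    rewrite -[leRHS]mulrA ler_wpM2l ?addr_ge0 ?mulr_ge0 ?exprn_ge0 //.
    exact/le_scale/(threshold_succ_le N_gt1 m_gt1 C0_gt0 K_le).
  by rewrite ler_wpM2l ?mulr_ge0 ?exprn_ge0 // sqrt_le_scale.
have s0_gt0 := start_size_gt0 R N_gt1 m_gt1.
have s0_le := double_start_size_le R N_gt1 m_gt1.
rewrite -(mul_scale R N_gt1 m_gt1); split.
- by move=> s _; exact: mean_time_from_le.
- by rewrite -muln2 in s0_le; lia.
have s0N : (start_size R N m <= N)%N.
  by apply: leq_trans s0_le; rewrite -addnn leq_addr.
have := mean_time_from_ge_hump N_gt0 adm (ler0n R C0) (ltnW m_gt1) s0_gt0 s0_le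
  (double_start_size_expm R N_gt1 m_gt1) (num_ones_first_ones s0N)
  (survival_cvg0 N_gt0 (tmU _)).
apply: le_trans.
rewrite lee_fin -/d ler_pdivlMr ?mulr_gt0 //.
have -> : (8 * d)^-1 * (N%:R * scale R N m) * (2 * d) =
    N%:R * (4^-1 * scale R N m) by field; rewrite gt_eqF.
by rewrite ler_wpM2l //; case/andP: (start_size_itv R N m).
Qed.

(** * Duality and the growth rate *)

Section Duality.
Variables (R : realType) (N r : nat) (f : boolean_rule r).
Implicit Types x : state N.

Lemma cube_complK n : involutive (@cube_compl n).
Proof. by move=> y; apply/ffunP => i; rewrite !ffunE negbK. Qed.

Lemma monotone_dual : monotone_rule f -> monotone_rule (dual f).
Proof.
move=> f_mon y z yz; apply: contra; apply: f_mon => i.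
by rewrite !ffunE; apply: contra; exact: yz.
Qed.

Lemma constant_dual : constant_rule (dual f) -> constant_rule f.
Proof.
move=> [b fb]; exists (~~ b) => y.
by rewrite -(fb (cube_compl y)) /dual cube_complK negbK.
Qed.

Lemma dictator_dual : dictator (dual f) -> dictator f.
Proof.
move=> [j fj]; exists j => y; have := fj (cube_compl y).
by rewrite /dual cube_complK ffunE => /negb_inj.
Qed.

Lemma num_ones_compl x : num_ones (cube_compl x) = (N - num_ones x)%N.
Proof.
rewrite /num_ones (_ : [set i | cube_compl x i]%SET = ~: [set i | x i]%SET)%SET.
  by rewrite cardsCs finset.setCK card_ord.
by apply/finset.setP => i; rewrite !finset.inE ffunE.
Qed.

Lemma consensus_compl x : consensus (cube_compl x) = consensus x.
Proof.
apply/existsP/existsP => -[b /forallP xb]; exists (~~ b); apply/forallP => i.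
  by have := xb i; rewrite ffunE; case: (x i) b {xb} => -[].
by have := xb i; rewrite ffunE; case: (x i) b {xb} => -[].
Qed.

Lemma step_compl x (d : draw N r) :
  step (dual f) (cube_compl x) d = cube_compl (step f x d).
Proof.
apply/ffunP => i; rewrite !ffunE; case: ifP => // _.
by rewrite /dual; congr (~~ f _); apply/ffunP => k; rewrite !ffunE negbK.
Qed.

Lemma hit_prob_dual x t :
  hit_prob R (dual f) (cube_compl x) t = hit_prob R f x t.
Proof.
elim: t x => [|t IHt] x.
  by rewrite !hit_prob0 consensus_compl.
rewrite !hit_probS consensus_compl; case: ifP => [_|_]; first by [].
by apply: eq_average => d; rewrite step_compl IHt.
Qed.

Lemma mean_time_dual s : (s <= N)%N ->
  mean_time R f N s = mean_time R (dual f) N (N - s).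
Proof.
move=> sN; rewrite
  -(@mean_time_from_num_ones _ _ (dual f) R (cube_compl (first_ones N s))).
  rewrite /mean_time /mean_time_from /never_prob.
  have <- : hit_prob R (dual f) (cube_compl (first_ones N s)) =
      hit_prob R f (first_ones N s).
    by apply/funext => t; exact: hit_prob_dual.
  reflexivity.
by rewrite num_ones_compl num_ones_first_ones.
Qed.

End Duality.

Lemma max_mean_time_le (R : realType) r (f : boolean_rule r) N U :
  (forall s, (1 <= s < N)%N -> (mean_time R f N s <= U)%E) ->
  (max_mean_time R f N <= U)%E.
Proof.
move=> sU; rewrite /max_mean_time big_nat_cond; apply: bigmax_le.
  exact: leNye.
by move=> s; rewrite andbT; exact: sU.
Qed.

Lemma mean_time_le_max (R : realType) r (f : boolean_rule r) N s :
  (1 <= s < N)%N -> (mean_time R f N s <= max_mean_time R f N)%E.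
Proof.
by move=> sN; apply: (le_bigmax_seq _ s xpredT (mean_time R f N));
  rewrite ?mem_index_iota.
Qed.

Section Theta.
Variables (R : realType) (r : nat) (f : boolean_rule r).
Hypotheses (f_mon : monotone_rule f) (f_nc : ~ constant_rule f).
Hypothesis f_nd : ~ dictator f.

Lemma max_mean_time_theta j (m := min_minterm_size (residual f j)) :
  D0 f = 1%N -> f (basis_vec j) ->
  exists c C : R, [/\ 0 < c, 0 < C & forall N, (2 <= N)%N ->
    let rate := N%:R `^ (2 - m%:R^-1) in
    let s := start_size R N m in
    [/\ ((c * rate)%:E <= max_mean_time R f N <= (C * rate)%:E)%E,
        (1 <= s <= N - 1)%N & ((c * rate)%:E <= mean_time R f N s)%E]].
Proof.
move=> f_D0 fj.
have [c [C [c0 C0 bounds]]] := mean_time_bounds R f_mon f_nc f_nd f_D0 fj.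
exists c, C; split; [exact: c0 | exact: C0 | move=> N N_gt1 rate s].
have [upper s_itv lower] := bounds N N_gt1.
split; [|exact: s_itv | exact: lower].
apply/andP; split; last exact: max_mean_time_le.
apply: le_trans lower _; apply: mean_time_le_max.
by rewrite -/m -/s in s_itv *; lia.
Qed.

Lemma max_mean_time_theta_dual j (m := min_minterm_size (residual (dual f) j)) :
  D1 f = 1%N -> dual f (basis_vec j) ->
  exists c C : R, [/\ 0 < c, 0 < C & forall N, (2 <= N)%N ->
    let rate := N%:R `^ (2 - m%:R^-1) in
    let s := (N - start_size R N m)%N in
    [/\ ((c * rate)%:E <= max_mean_time R f N <= (C * rate)%:E)%E,
        (1 <= s <= N - 1)%N & ((c * rate)%:E <= mean_time R f N s)%E]].
Proof.
move=> f_D1 fj.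
have [c [C [c0 C0 bounds]]] := mean_time_bounds R (monotone_dual f_mon)
  (fun h => f_nc (constant_dual h)) (fun h => f_nd (dictator_dual h)) f_D1 fj.
exists c, C; split; [exact: c0 | exact: C0 | move=> N N_gt1 rate s].
have [upper s_itv lower] := bounds N N_gt1.
have s_itv' : (1 <= s <= N - 1)%N by rewrite -/m /s in s_itv *; lia.
have lower' : ((c * rate)%:E <= mean_time R f N s)%E.
  rewrite (mean_time_dual R f (leq_subr _ _)) subKn; first exact: lower.
  by rewrite -/m in s_itv; lia.
split; [|exact: s_itv' | exact: lower'].
apply/andP; split.
  by apply: le_trans lower' _; apply: mean_time_le_max; lia.
apply: max_mean_time_le => t t_itv.
have tN : (t <= N)%N by lia.
by rewrite (mean_time_dual R f tN); apply: upper; lia.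
Qed.

End Theta.

(** The rate is at least N^(3/2), while ln N = 4 ln w <= 4 w with w =
    N^(1/4). *)
Lemma not_NlogN (R : realType) (F : nat -> \bar R) (c : R) m :
  0 < c -> (2 <= m)%N ->
  (forall N, (2 <= N)%N -> ((c * N%:R `^ (2 - m%:R^-1))%:E <= F N)%E) ->
  ~ exists C : R,
    (\forall N \near \oo, (F N <= (C * (N%:R * ln N%:R))%:E)%E)%classic.
Proof.
move=> c0 m2 Fge [C FC].
pose X : R := 4 * `|C| / c + 1.
have [N [FN [N2 NX]]] := filter_ex (filterI FC
  (filterI (nbhs_infty_ge 2) (nbhs_infty_ger (X ^+ 4)))).
have NR : 2 <= N%:R :> R by rewrite ler_nat.
have N0 : 0 < N%:R :> R by lra.
have mR : 2 <= m%:R :> R by rewrite ler_nat.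
pose w : R := N%:R `^ 4^-1.
have w0 : 0 < w by rewrite powR_gt0.
have w4 : w ^+ 4 = N%:R.
  by rewrite -powR_mulrn ?powR_ge0 // -powRrM mulVf // powRr1.
have X0 : 0 <= X by rewrite addr_ge0 // divr_ge0 ?mulr_ge0 // ltW.
have Xw : X <= w by rewrite -(ler_pXn2r (n := 4)) ?nnegrE ?(ltW w0) // w4.
have rate_ge : N%:R * w ^+ 2 <= N%:R `^ (2 - m%:R^-1).
  have -> : N%:R * w ^+ 2 = N%:R `^ (1 + 2^-1).
    rewrite powRD; last by apply/implyP => _; rewrite gt_eqF.
    rewrite powRr1 // -powR_mulrn ?powR_ge0 // -powRrM.
    by congr (_ * _ `^ _); field.
  apply: ler_powR; first lra.
  have : m%:R^-1 <= 2^-1 :> R by rewrite lef_pV2 ?posrE //; lra.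
  lra.
have ln_le : ln N%:R <= 4 * w.
  rewrite -w4 lnXn // -[leLHS]mulr_natl ler_wpM2l //.
  have w1 : -1 < w - 1 by lra.
  by have := le_ln1Dx w1; rewrite [1 + _]addrC subrK; lra.
have : ((c * (N%:R * w ^+ 2))%:E <= (`|C| * (N%:R * (4 * w)))%:E)%E.
  apply: le_trans (le_trans _ (Fge N N2)) (le_trans FN _).
    by rewrite lee_fin ler_pM2l.
  rewrite lee_fin.
  have ln0 : 0 <= ln N%:R :> R by rewrite ln_ge0 //; lra.
  apply: (@le_trans _ _ (`|C| * (N%:R * ln N%:R))).
    by rewrite ler_wpM2r ?ler_norm // mulr_ge0.
  by rewrite ler_wpM2l // ler_wpM2l.
rewrite lee_fin [leLHS]mulrCA [leRHS]mulrCA ler_pM2l //.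
have -> : `|C| * (4 * w) = c * (X - 1) * w by rewrite /X; field; rewrite gt_eqF.
rewrite expr2 mulrA ler_pM2r // ler_pM2l //; lra.
Qed.

Lemma cvg_two_minus_inv (R : realType) :
  ((fun m : nat => 2 - m%:R^-1 : R) @ \oo --> (2 : R))%classic.
Proof.
rewrite -[X in (_ --> X)%classic](subr0 2); apply: cvgB; first exact: cvg_cst.
rewrite -(cvg_shiftS (fun n => n%:R^-1 : R)); exact: cvg_harmonic.
Qed.

Local Open Scope classical_set_scope.
Local Open Scope ring_scope.

Theorem theorem22 (R : realType) (r : nat) (f : boolean_rule r)
    (f_monotone : monotone_rule f) (f_nonconstant : ~ constant_rule f)
    (f_not_dictator : ~ dictator f) :
  (D0 f = 1%N -> forall j : 'I_r, f (basis_vec j) ->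
    let m := min_minterm_size (residual f j) in
    [/\ forall x, f x = x j || residual f j (delete j x),
        (2 <= m)%N
      & exists c C eps : R, [/\ 0 < c, 0 < C, 0 < eps
        & forall N : nat, (2 <= N)%N ->
          let rate := N%:R `^ (2 - m%:R^-1) in
          let s := `|Num.ceil (eps * N%:R `^ ((m%:R - 1) / m%:R))|%N in
          [/\ ((c * rate)%:E <= max_mean_time R f N <= (C * rate)%:E)%E,
              (1 <= s <= N - 1)%N
            & ((c * rate)%:E <= mean_time R f N s)%E]]])
  /\
  (D1 f = 1%N -> forall j : 'I_r, dual f (basis_vec j) ->
    let m := min_minterm_size (residual (dual f) j) in
    (2 <= m)%N /\
    exists c C eps : R, [/\ 0 < c, 0 < C, 0 < eps
      & forall N : nat, (2 <= N)%N ->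
        let rate := N%:R `^ (2 - m%:R^-1) in
        let s := (N - `|Num.ceil (eps * N%:R `^ ((m%:R - 1) / m%:R))|)%N in
        [/\ ((c * rate)%:E <= max_mean_time R f N <= (C * rate)%:E)%E,
            (1 <= s <= N - 1)%N
          & ((c * rate)%:E <= mean_time R f N s)%E]])
  /\
  (D0 f = 1%N \/ D1 f = 1%N ->
    ~ exists C : R, \forall N \near \oo,
        (max_mean_time R f N <= (C * (N%:R * ln N%:R))%:E)%E)
  /\
  (fun m : nat => 2 - m%:R^-1 : R) @ \oo --> (2 : R).
Proof.
have dual_mon := monotone_dual f_monotone.
have dual_nc : ~ constant_rule (dual f) by move/constant_dual.
have dual_nd : ~ dictator (dual f) by move/dictator_dual.
have theta0 := max_mean_time_theta R f_monotone f_nonconstant f_not_dictator.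
have theta1 :=
  max_mean_time_theta_dual R f_monotone f_nonconstant f_not_dictator.
split; [|split; [|split; last exact: cvg_two_minus_inv]].
- move=> f_D0 j fj m; split; first exact: residualE.
    exact: residual_min_minterm_size_ge2.
  have [c [C [c0 C0 bounds]]] := theta0 j f_D0 fj.
  by exists c, C, 4^-1.
- move=> f_D1 j fj m; split; first exact: residual_min_minterm_size_ge2.
  have [c [C [c0 C0 bounds]]] := theta1 j f_D1 fj.
  by exists c, C, 4^-1.
case=> f_D; have /eqP/cards1P[j /finset.setP/(_ j)] := f_D;
  rewrite !finset.inE eqxx => fj.
- have [c [C [c0 _ bounds]]] := theta0 j f_D fj.
  apply: (not_NlogN c0 (m := min_minterm_size (residual f j))).
    exact: residual_min_minterm_size_ge2.
  by move=> N /bounds[/andP[]].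
have [c [C [c0 _ bounds]]] := theta1 j f_D fj.
apply: (not_NlogN c0 (m := min_minterm_size (residual (dual f) j))).
  exact: residual_min_minterm_size_ge2.
by move=> N /bounds[/andP[]].
Qed.
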